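(* Let $v\in\mathbb{R}$, let $N$ be a positive integer, and let $a_0,a_1,\dots,a_{2N-1}$ be arbitrary complex constants. For $n\in\{0,1\}$ and positive integers $r,s$ define $$ m_{r,s}^{(n)}=\left.\sum_{k=0}^{r}\frac{a_k}{(r-k)!}\,\bigl(p\,\partial_p+\xi+n\bigr)^{r-k}\;\sum_{l=0}^{s}\frac{\overline{a}_l}{(s-l)!}\,\bigl(q\,\partial_q+\eta-n\bigr)^{s-l}\;\frac{1}{p+q}\right|_{p=1,\;q=1}, $$ where $$ \xi=p\,x+\bigl(2\mathrm{i}p^{2}-3vp^{3}-3vp\bigr)t,\qquad \eta=q\,x-\bigl(2\mathrm{i}q^{2}+3vq^{3}+3vq\bigr)t, $$ and let $$ \tau_n=\det_{1\le r,s\le N}\bigl(m^{(n)}_{2r-1,\,2s-1}\bigr),\qquad n=0,1. $$ Then $$ \phi_N(x,t)=e^{2\mathrm{i}t}\,\frac{\tau_1}{\tau_0} $$ is a (rational-type) solution of the Hirota equation $$ \mathrm{i}\phi_t+\phi_{xx}+2|\phi|^2\phi+\mathrm{i}v\,\phi_{xxx}+6\mathrm{i}v\,|\phi|^2\phi_x=0 $$ at every point $(x,t)\in\mathbb{R}^2$ where $\tau_0\neq 0$.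
   Context: Here $\mathrm{i}=\sqrt{-1}$ and the bar denotes complex conjugation. In the definition of $m^{(n)}_{r,s}$, $p,q$ are auxiliary variables; $\xi$ (a function of $p,x,t$) and $\eta$ (a function of $q,x,t$) act by multiplication, $\partial_p,\partial_q$ are partial derivatives, the operator powers $(p\partial_p+\xi+n)^{r-k}$ and $(q\partial_q+\eta-n)^{s-l}$ are applied to the function $1/(p+q)$, and the result is evaluated at $p=q=1$. The indices $r,s$ of the matrix entries are positive integers (distinct from the imaginary unit). *)

(* Defs.v *)
From Stdlib Require Import Reals ClassicalEpsilon Factorial.
Open Scope R_scope.

Record Cplx : Type := mkC { Re : R ; Im : R }.

Definition C0 : Cplx := mkC 0 0.
Definition C1 : Cplx := mkC 1 0.
Definition Ci : Cplx := mkC 0 1.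
Definition RtoC (r : R) : Cplx := mkC r 0.
Definition Cadd (z w : Cplx) : Cplx := mkC (Re z + Re w) (Im z + Im w).
Definition Copp (z : Cplx) : Cplx := mkC (- Re z) (- Im z).
Definition Csub (z w : Cplx) : Cplx := Cadd z (Copp w).
Definition Cmul (z w : Cplx) : Cplx :=
  mkC (Re z * Re w - Im z * Im w) (Re z * Im w + Im z * Re w).
Definition Cnorm2 (z : Cplx) : R := Re z * Re z + Im z * Im z.
Definition Cconj (z : Cplx) : Cplx := mkC (Re z) (- Im z).
(* multiplicative inverse (Cinv 0 = 0, irrelevant here) *)
Definition Cinv (z : Cplx) : Cplx := mkC (Re z / Cnorm2 z) (- Im z / Cnorm2 z).
Definition Cdiv (z w : Cplx) : Cplx := Cmul z (Cinv w).
Fixpoint Cpow (z : Cplx) (n : nat) : Cplx :=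
  match n with O => C1 | S k => Cmul z (Cpow z k) end.
Definition Cexpi (th : R) : Cplx := mkC (cos th) (sin th).

Fixpoint Csum (n : nat) (f : nat -> Cplx) : Cplx :=
  match n with O => f O | S k => Cadd (Csum k f) (f (S k)) end.

Definition Cderiv (f : R -> Cplx) (x : R) (l : Cplx) : Prop :=
  derivable_pt_lim (fun y => Re (f y)) x (Re l) /\
  derivable_pt_lim (fun y => Im (f y)) x (Im l).

Definition Cdiff (f : R -> Cplx) (x : R) : Prop := exists l, Cderiv f x l.

(** the derivative f'(x) (meaningful when Cdiff f x holds; chosen by epsilon) *)
Definition Cder (f : R -> Cplx) (x : R) : Cplx :=
  epsilon (inhabits C0) (fun l => Cderiv f x l).

Definition minor0 (M : nat -> nat -> Cplx) (j : nat) : nat -> nat -> Cplx :=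
  fun i' j' => M (S i') (if Nat.ltb j' j then j' else S j').

Fixpoint Cdet (n : nat) (M : nat -> nat -> Cplx) : Cplx :=
  match n with
  | O => C1
  | S k => Csum k (fun j =>
             Cmul (Cmul (Cpow (Copp C1) j) (M O j)) (Cdet k (minor0 M j)))
  end.

Definition xi (v x t p : R) : Cplx :=
  Cadd (RtoC (p * x))
       (Cmul (mkC (- 3 * v * p ^ 3 - 3 * v * p) (2 * p ^ 2)) (RtoC t)).

Definition eta (v x t q : R) : Cplx :=
  Copp (Cadd (RtoC (- (q * x)))
       (Cmul (mkC (3 * v * q ^ 3 + 3 * v * q) (2 * q ^ 2)) (RtoC t))).

Definition Lp (v x t : R) (n : nat) (g : R -> Cplx) : R -> Cplx :=
  fun p => Cadd (Cmul (RtoC p) (Cder g p)) (Cmul (Cadd (xi v x t p) (RtoC (INR n))) (g p)).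

Definition Lq (v x t : R) (n : nat) (h : R -> Cplx) : R -> Cplx :=
  fun q => Cadd (Cmul (RtoC q) (Cder h q)) (Cmul (Csub (eta v x t q) (RtoC (INR n))) (h q)).

Definition Cfact (k : nat) : Cplx := RtoC (INR (fact k)).

(** m^{(n)}_{r,s}: the q-operator is applied to q |-> 1/(p+q) for each fixed p,
    evaluated at q = 1; the p-operator is then applied to the resulting
    function of p and evaluated at p = 1. *)
Definition m_entry (a : nat -> Cplx) (v x t : R) (n r s : nat) : Cplx :=
  let G : R -> Cplx := fun p =>
    Csum s (fun l =>
      Cmul (Cdiv (Cconj (a l)) (Cfact (s - l)))
           (Nat.iter (s - l) (Lq v x t n) (fun q => Cinv (RtoC (p + q))) 1)) in
  Csum r (fun k =>
    Cmul (Cdiv (a k) (Cfact (r - k)))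
         (Nat.iter (r - k) (Lp v x t n) G 1)).

(** tau_n = det_{1<=r,s<=N} m^{(n)}_{2r-1,2s-1}  (0-based indices i = r-1, j = s-1) *)
Definition tau (a : nat -> Cplx) (v : R) (N n : nat) (x t : R) : Cplx :=
  Cdet N (fun i j => m_entry a v x t n (2 * i + 1) (2 * j + 1)).

Definition phiN (a : nat -> Cplx) (v : R) (N : nat) (x t : R) : Cplx :=
  Cmul (Cexpi (2 * t)) (Cdiv (tau a v N 1 x t) (tau a v N 0 x t)).

(* Main.v *)
From Stdlib Require Import Reals Lra.
Require Import Defs.

(** Write [p = exp kappa], [q = exp lambda]: the entries [m_{r,s}] are Taylor
coefficients in [kappa, lambda] at [0].  For integers [i, j] put
[Phi_i = L(p^i)], [Psi_j = L(q^j)] (the odd jets of the exponential phase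
weighted by the [a_k]) and let [M] be the matrix of [tau_0].  Since [x] and [t]
act on [1/(p+q)] by symbols divisible by [p+q], the derivatives of [M] are sums
of products [Phi_i Psi_j], e.g. [M_x = Phi_0 Psi_0 - 2M].  Since
[p + 1/p = 2 cosh kappa] is even in [kappa], it acts on the odd jets by a
constant matrix [J], whence the Sylvester equation
[J M + M J^T = Phi_0 Psi_0 + Phi_{-1} Psi_{-1}].

No bilinear identity is needed.  The scalars [S_{ij} = Psi_j M^{-1} Phi_i]
satisfy [conj S_{ij} = S_{ji}], the matrix determinant lemma gives
[tau_1/tau_0 = (-1)^N (1 - S_{0,-1})], the derivatives of the [S_{ij}] in [x]
and [t] are quadratic in the [S_{ij}], and the Sylvester equation gives
[S_{i+1,j} + S_{i-1,j} + S_{i,j+1} + S_{i,j-1}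
 = S_{0,j} S_{i,0} + S_{-1,j} S_{i,-1}].
After eliminating [S_{01}, S_{11}, S_{02}] with this recurrence, the Hirota
equation is a polynomial identity, which splits into its NLS part and its
mKdV part. *)

(** * Calculus of complex-valued functions of a real variable *)

Local Open Scope R_scope.

Lemma Cplx_ext (z w : Cplx) : Re z = Re w -> Im z = Im w -> z = w.
Proof. destruct z, w; simpl; intros -> ->; reflexivity. Qed.

Lemma Cderiv_const (c : Cplx) (x : R) : Cderiv (fun _ => c) x C0.
Proof. split; apply derivable_pt_lim_const. Qed.

Lemma Cderiv_RtoC (x : R) : Cderiv RtoC x C1.
Proof.
split; [apply (derivable_pt_lim_id x)|exact (derivable_pt_lim_const 0 x)].
Qed.

Lemma Cderiv_add (f g : R -> Cplx) (x : R) (l m : Cplx) :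
  Cderiv f x l -> Cderiv g x m ->
  Cderiv (fun y => Cadd (f y) (g y)) x (Cadd l m).
Proof.
intros [f1 f2] [g1 g2]; split; simpl;
  [exact (derivable_pt_lim_plus _ _ _ _ _ f1 g1)
  |exact (derivable_pt_lim_plus _ _ _ _ _ f2 g2)].
Qed.

Lemma Cderiv_mul (f g : R -> Cplx) (x : R) (l m : Cplx) :
  Cderiv f x l -> Cderiv g x m ->
  Cderiv (fun y => Cmul (f y) (g y)) x
         (Cadd (Cmul l (g x)) (Cmul (f x) m)).
Proof.
intros [f1 f2] [g1 g2]; split.
- replace (Re _) with ((Re l * Re (g x) + Re (f x) * Re m)
                       - (Im l * Im (g x) + Im (f x) * Im m)) by (simpl; ring).
  exact (derivable_pt_lim_minus _ _ _ _ _
    (derivable_pt_lim_mult _ _ _ _ _ f1 g1)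
    (derivable_pt_lim_mult _ _ _ _ _ f2 g2)).
- replace (Im _) with ((Re l * Im (g x) + Re (f x) * Im m)
                       + (Im l * Re (g x) + Im (f x) * Re m)) by (simpl; ring).
  exact (derivable_pt_lim_plus _ _ _ _ _
    (derivable_pt_lim_mult _ _ _ _ _ f1 g2)
    (derivable_pt_lim_mult _ _ _ _ _ f2 g1)).
Qed.

Lemma Cnorm2_gt0 (z : Cplx) : z <> C0 -> 0 < Cnorm2 z.
Proof.
intros zn0; unfold Cnorm2.
destruct (Req_dec (Re z) 0) as [r0|]; [|nra].
destruct (Req_dec (Im z) 0) as [i0|]; [|nra].
now case zn0; apply Cplx_ext.
Qed.

Lemma Cmul_Cinv (z : Cplx) : z <> C0 -> Cmul z (Cinv z) = C1.
Proof.
intros zn0; assert (h := Cnorm2_gt0 z zn0).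
unfold Cnorm2 in h; apply Cplx_ext; simpl; unfold Cnorm2; field; lra.
Qed.

Lemma Cderiv_inv (f : R -> Cplx) (x : R) (l : Cplx) :
  f x <> C0 -> Cderiv f x l ->
  Cderiv (fun y => Cinv (f y)) x
         (Copp (Cmul l (Cmul (Cinv (f x)) (Cinv (f x))))).
Proof.
intros fn0 [f1 f2]; assert (h := Cnorm2_gt0 _ fn0).
assert (hn : derivable_pt_lim (fun y => Cnorm2 (f y)) x
   ((Re l * Re (f x) + Re (f x) * Re l) + (Im l * Im (f x) + Im (f x) * Im l))).
  exact (derivable_pt_lim_plus _ _ _ _ _
    (derivable_pt_lim_mult _ _ _ _ _ f1 f1)
    (derivable_pt_lim_mult _ _ _ _ _ f2 f2)).
assert (h' : Cnorm2 (f x) <> 0) by lra.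
split.
- assert (d := derivable_pt_lim_div _ _ _ _ _ f1 hn h').
  match type of d with derivable_pt_lim _ _ ?e => replace (Re _) with e end.
    exact d.
  unfold Cnorm2, Rsqr in *; simpl; unfold Cnorm2; field; exact h'.
- assert (d := derivable_pt_lim_div _ _ _ _ _ (derivable_pt_lim_opp _ _ _ f2) hn h').
  match type of d with derivable_pt_lim _ _ ?e => replace (Im _) with e end.
    exact d.
  unfold Cnorm2, Rsqr, opp_fct in *; simpl; unfold Cnorm2; field; exact h'.
Qed.

(** Closed forms are available only near a point, where a determinant is nonzero or where [p > 0];
    this transfers their derivatives. *)
Lemma Cderiv_ext_loc (f g : R -> Cplx) (x d : R) (l : Cplx) :
  0 < d -> (forall y, Rabs (y - x) < d -> f y = g y) ->
  Cderiv f x l -> Cderiv g x l.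
Proof.
intros d0 fg [f1 f2].
assert (hx : f x = g x) by (apply fg; rewrite Rminus_diag, Rabs_R0; exact d0).
assert (ext : forall h k : Cplx -> R, h = k -> forall m,
  derivable_pt_lim (fun y => h (f y)) x m -> derivable_pt_lim (fun y => k (g y)) x m).
  intros h k <- m dh e e0; destruct (dh e e0) as [a ha].
  exists (mkposreal _ (Rmin_pos _ _ (cond_pos a) d0)); simpl; intros y y0 hy.
  rewrite <- hx, <- fg.
    apply ha; [exact y0|]; apply (Rlt_le_trans _ _ _ hy), Rmin_l.
  replace (x + y - x) with y by ring.
  apply (Rlt_le_trans _ _ _ hy), Rmin_r.
split; [exact (ext Re Re eq_refl _ f1)|exact (ext Im Im eq_refl _ f2)].
Qed.

Lemma Cderiv_ext (f g : R -> Cplx) (x : R) (l : Cplx) :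
  (forall y, f y = g y) -> Cderiv f x l -> Cderiv g x l.
Proof. intros fg; apply (Cderiv_ext_loc f g x 1 l Rlt_0_1); auto. Qed.

Lemma Cder_eq (f : R -> Cplx) (x : R) (l : Cplx) : Cderiv f x l -> Cder f x = l.
Proof.
intros df; unfold Cder.
assert (h := ClassicalEpsilon.epsilon_spec (inhabits C0) _ (ex_intro _ l df)).
destruct df as [d1 d2], h as [h1 h2].
apply Cplx_ext; [exact (uniqueness_limite _ _ _ _ h1 d1)
                |exact (uniqueness_limite _ _ _ _ h2 d2)].
Qed.

Lemma Cderiv_neq0 (f : R -> Cplx) (x : R) (l : Cplx) :
  Cderiv f x l -> f x <> C0 ->
  exists d, 0 < d /\ forall y, Rabs (y - x) < d -> f y <> C0.
Proof.
intros df fn0; assert (h := Cnorm2_gt0 _ fn0); destruct df as [d1 d2].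
assert (c : continuity_pt (fun y => Cnorm2 (f y)) x).
  apply derivable_continuous_pt; eexists.
  exact (derivable_pt_lim_plus _ _ _ _ _
    (derivable_pt_lim_mult _ _ _ _ _ d1 d1)
    (derivable_pt_lim_mult _ _ _ _ _ d2 d2)).
destruct (c _ h) as [d [d0 hd]]; exists d; split; [exact d0|].
intros y hy fy0.
(* Continuity is stated on a punctured neighbourhood, so the centre is treated apart. *)
destruct (Req_dec x y) as [<-|xy]; [easy|].
assert (k := hd y (conj (conj I xy) hy)); cbn in k; unfold Rdist in k.
rewrite fy0 in k; revert k; unfold Cnorm2 at 1; simpl.
rewrite <- Rabs_Ropp, Rabs_pos_eq; lra.
Qed.

Lemma Cderiv_expi (c x : R) :
  Cderiv (fun y => Cexpi (c * y)) x (Cmul (mkC 0 c) (Cexpi (c * x))).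
Proof.
assert (hc : derivable_pt_lim (fun y => c * y) x (c * 1)).
  exact (derivable_pt_lim_scal _ c _ _ (derivable_pt_lim_id x)).
split; simpl.
- replace (_ - _) with (- sin (c * x) * (c * 1)) by ring.
  exact (derivable_pt_lim_comp _ _ _ _ _ hc (derivable_pt_lim_cos (c * x))).
- replace (_ + _) with (cos (c * x) * (c * 1)) by ring.
  exact (derivable_pt_lim_comp _ _ _ _ _ hc (derivable_pt_lim_sin (c * x))).
Qed.

(** * Phases as cubic polynomials, and the laws of complex arithmetic *)

Lemma xiE (v x t p : R) :
  xi v x t p = Cadd (Cadd (Cmul (RtoC (x - 3 * v * t)) (RtoC p))
                          (Cmul (mkC 0 (2 * t)) (Cmul (RtoC p) (RtoC p))))
                    (Cmul (RtoC (- 3 * v * t))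
                          (Cmul (RtoC p) (Cmul (RtoC p) (RtoC p)))).
Proof. apply Cplx_ext; simpl; ring. Qed.

Lemma etaE (v x t q : R) :
  eta v x t q = Cadd (Cadd (Cmul (RtoC (x - 3 * v * t)) (RtoC q))
                           (Cmul (mkC 0 (- 2 * t)) (Cmul (RtoC q) (RtoC q))))
                     (Cmul (RtoC (- 3 * v * t))
                           (Cmul (RtoC q) (Cmul (RtoC q) (RtoC q)))).
Proof. apply Cplx_ext; simpl; ring. Qed.

Lemma RtoC_add (r s : R) : RtoC (r + s) = Cadd (RtoC r) (RtoC s).
Proof. apply Cplx_ext; simpl; ring. Qed.

Lemma RtoC_INR_S (n : nat) : RtoC (INR (S n)) = Cadd (RtoC (INR n)) C1.
Proof. rewrite S_INR; apply Cplx_ext; simpl; ring. Qed.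

Lemma RtoC_eq0 (r : R) : RtoC r = C0 -> r = 0.
Proof. intros [=]; assumption. Qed.

Lemma CaddA (x y z : Cplx) : Cadd x (Cadd y z) = Cadd (Cadd x y) z.
Proof. apply Cplx_ext; simpl; ring. Qed.
Lemma CaddC (x y : Cplx) : Cadd x y = Cadd y x.
Proof. apply Cplx_ext; simpl; ring. Qed.
Lemma Cadd0 (x : Cplx) : Cadd C0 x = x.
Proof. apply Cplx_ext; simpl; ring. Qed.
Lemma CaddN (x : Cplx) : Cadd (Copp x) x = C0.
Proof. apply Cplx_ext; simpl; ring. Qed.
Lemma CmulA (x y z : Cplx) : Cmul x (Cmul y z) = Cmul (Cmul x y) z.
Proof. apply Cplx_ext; simpl; ring. Qed.
Lemma CmulC (x y : Cplx) : Cmul x y = Cmul y x.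
Proof. apply Cplx_ext; simpl; ring. Qed.
Lemma Cmul1 (x : Cplx) : Cmul C1 x = x.
Proof. apply Cplx_ext; simpl; ring. Qed.
Lemma CmulDl (x y z : Cplx) : Cmul (Cadd x y) z = Cadd (Cmul x z) (Cmul y z).
Proof. apply Cplx_ext; simpl; ring. Qed.
Lemma C1_neq0 : C1 <> C0.
Proof. intros [=]; lra. Qed.
Lemma Cinv0 : Cinv C0 = C0.
Proof. apply Cplx_ext; simpl; unfold Rdiv; ring. Qed.

Lemma CconjD (z w : Cplx) : Cconj (Cadd z w) = Cadd (Cconj z) (Cconj w).
Proof. apply Cplx_ext; simpl; ring. Qed.
Lemma CconjN (z : Cplx) : Cconj (Copp z) = Copp (Cconj z).
Proof. apply Cplx_ext; simpl; ring. Qed.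
Lemma CconjM (z w : Cplx) : Cconj (Cmul z w) = Cmul (Cconj z) (Cconj w).
Proof. apply Cplx_ext; simpl; ring. Qed.
Lemma Cconj1 : Cconj C1 = C1.
Proof. apply Cplx_ext; simpl; ring. Qed.
Lemma CconjK (z : Cplx) : Cconj (Cconj z) = z.
Proof. apply Cplx_ext; simpl; ring. Qed.
Lemma RtoC_Cnorm2 (z : Cplx) : RtoC (Cnorm2 z) = Cmul z (Cconj z).
Proof. apply Cplx_ext; simpl; unfold Cnorm2; ring. Qed.
Lemma Cexpi_conj (s : R) : Cmul (Cexpi s) (Cconj (Cexpi s)) = C1.
Proof.
apply Cplx_ext; simpl; [|ring].
assert (h := sin2_cos2 s); unfold Rsqr in h; lra.
Qed.

(** * The field of complex numbers *)

From HB Require Import structures.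
From mathcomp Require Import all_boot perm ssralg ssrint poly matrix zmodp.
From mathcomp Require Import boolp ring.

Set Implicit Arguments.
Unset Strict Implicit.
Unset Printing Implicit Defensive.
Import GRing.Theory.
Local Open Scope ring_scope.

HB.instance Definition _ := gen_eqMixin Cplx.
HB.instance Definition _ := gen_choiceMixin Cplx.
HB.instance Definition _ := GRing.isZmodule.Build Cplx CaddA CaddC Cadd0 CaddN.

Fact C1_neqb0 : C1 != 0 :> Cplx.
Proof. by apply/eqP; exact: C1_neq0. Qed.

HB.instance Definition _ :=
  GRing.Zmodule_isComNzRing.Build Cplx CmulA CmulC Cmul1 CmulDl C1_neqb0.

Fact Cplx_mulVf (z : Cplx) : z != 0 -> Cmul (Cinv z) z = C1.
Proof. by move=> /eqP z0; rewrite CmulC; exact: Cmul_Cinv. Qed.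

HB.instance Definition _ := GRing.ComNzRing_isField.Build Cplx Cplx_mulVf Cinv0.

Fact Cconj_is_additive : zmod_morphism Cconj.
Proof. by move=> z w; rewrite -[w in RHS]opprK; rewrite [LHS]CconjD CconjN opprK. Qed.
HB.instance Definition _ := GRing.isZmodMorphism.Build Cplx Cplx Cconj Cconj_is_additive.
Fact Cconj_is_monoid_morphism : monoid_morphism Cconj.
Proof. by split; [exact: Cconj1|exact: CconjM]. Qed.
HB.instance Definition _ := GRing.isMonoidMorphism.Build Cplx Cplx Cconj Cconj_is_monoid_morphism.

Lemma natCplx (n : nat) : n%:R = RtoC (INR n).
Proof. by elim: n => [//|n IH]; rewrite RtoC_INR_S -IH -addn1 natrD. Qed.

Lemma natCplx_neq0 (n : nat) : n.+1%:R != 0 :> Cplx.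
Proof. by rewrite natCplx; apply/eqP => /RtoC_eq0; exact: not_0_INR. Qed.

(** * Jets at [p = q = 1] *)

Section ConvolutionJets.
Variable F : fieldType.

Definition conv (f g : nat -> F) (r : nat) : F :=
  \sum_(u < r.+1) f u * g (r - u)%N.

(** [conv] is the product of power series; truncation to polynomials of degree at most [r] reduces
    the claim to commutativity. *)
Lemma convCA (f g h : nat -> F) (r : nat) :
  conv f (conv g h) r = conv g (conv f h) r.
Proof.
pose P (f : nat -> F) := \poly_(i < r.+1) f i.
have PM f1 g1 s : (s <= r)%N -> (P f1 * P g1)`_s = conv f1 g1 s.
  move=> sr; rewrite coefM; apply: eq_bigr => u _; rewrite !coef_poly !ltnS.
  by rewrite (leq_trans (leq_subr _ _) sr) (leq_trans (leq_ord u) sr).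
have PMM f1 g1 h1 : (P f1 * (P g1 * P h1))`_r = conv f1 (conv g1 h1) r.
  rewrite coefM; apply: eq_bigr => u _.
  by rewrite PM ?leq_subr // coef_poly ltnS leq_ord.
by rewrite -!PMM mulrCA.
Qed.

Lemma eq_conv (f g g' : nat -> F) (r : nat) :
  g =1 g' -> conv f g r = conv f g' r.
Proof. by move=> e; apply: eq_bigr => u _; rewrite e. Qed.

Lemma convDr (f g h : nat -> F) (r : nat) :
  conv f (fun k => g k + h k) r = conv f g r + conv f h r.
Proof. by rewrite -big_split; apply: eq_bigr => u _; rewrite mulrDr. Qed.

Lemma convZr (c : F) (f g : nat -> F) (r : nat) :
  conv f (fun k => c * g k) r = c * conv f g r.
Proof. by rewrite mulr_sumr; apply: eq_bigr => u _; rewrite mulrCA. Qed.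

Variables (alpha gamma : F).

(** The Euler operator [p d/dp + alpha p + beta p^2 + gamma p^3] sends [p^i/(p+q)^m] to
    [i p^i/(p+q)^m - m p^(i+1)/(p+q)^(m+1)] plus the phase terms. [jet_step] composes a linear
    functional [e], given on these monomials, with that operator. *)
Definition jet_step (beta : F) (e : int -> nat -> F) (i : int) (m : nat) : F :=
  i%:~R * e i m - m%:R * e (i + 1) m.+1
  + (alpha * e (i + 1) m + beta * e (i + 2) m + gamma * e (i + 3) m).

Lemma eq_jet_step (beta : F) (e e' : int -> nat -> F) :
  e =2 e' -> jet_step beta e =2 jet_step beta e'.
Proof. by move=> ee i m; rewrite /jet_step !ee. Qed.

(* [qjet l j m] is [(q d/dq + alpha q + beta q^2 + gamma q^3)^l (q^j/(p+q)^m)]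
   at [q = 1], and [jet k l i j m] is the two-variable analogue for
   [p^i q^j/(p+q)^m] at [p = q = 1]; the recursions apply the innermost operator
   first.  A shift of the operator by [n] amounts to a shift of [i] or [j]. *)
Fixpoint qjet (beta p : F) (l : nat) (j : int) (m : nat) : F :=
  if l is l'.+1 then jet_step beta (qjet beta p l') j m else (p + 1) ^- m.

Fixpoint jet (beta beta' : F) (k l : nat) (i j : int) (m : nat) : F :=
  if k is k'.+1 then jet_step beta (fun i' m' => jet beta beta' k' l i' j m') i m
  else qjet beta' 1 l j m.

(** Since [(p+q) q^j/(p+q)^(m+1) = q^j/(p+q)^m] and [p] is constant for the operator in [q], the
    relation survives every step. *)
Lemma qjet_rel (beta p : F) l j m : p + 1 != 0 ->
  p * qjet beta p l j m.+1 + qjet beta p l (j + 1) m.+1 = qjet beta p l j m.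
Proof.
move=> p0; elim: l j m => [|l IH] j m /=.
  by rewrite -[X in _ + X]mul1r -mulrDl exprS invfM mulVKf.
have {}IH i n : qjet beta p l (i + 1) n.+1 = qjet beta p l i n - p * qjet beta p l i n.+1.
  by rewrite -(IH i n); ring.
rewrite /jet_step (addrAC j 1 2) (addrAC j 1 3) !IH rmorphD /=.
ring.
Qed.

Hypothesis natr_neq0 : forall n, n.+1%:R != 0 :> F.

Let two_neq0 : 1 + 1 != 0 :> F. Proof. exact: (natr_neq0 1). Qed.

Lemma jet_rel (beta beta' : F) k l i j m :
  jet beta beta' k l (i + 1) j m.+1 + jet beta beta' k l i (j + 1) m.+1
    = jet beta beta' k l i j m.
Proof.
elim: k i m => [|k IH] i m /=.
  by have := qjet_rel beta' l j m two_neq0; rewrite mul1r.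
have {}IH i' n : jet beta beta' k l (i' + 1) j n.+1
   = jet beta beta' k l i' j n - jet beta beta' k l i' (j + 1) n.+1.
  by rewrite -(IH i' n); ring.
rewrite /jet_step (addrAC i 1 2) (addrAC i 1 3) !IH rmorphD /=.
ring.
Qed.

(** Without a pole the variables separate: the coupling term of [jet_step] carries the factor
    [m = 0]. *)
Lemma jet0 (beta beta' : F) k l i j :
  jet beta beta' k l i j 0 = qjet beta 1 k i 0 * qjet beta' 1 l j 0.
Proof.
elim: k i => [|k IH] i /=; first by rewrite expr0 invr1 mul1r.
by rewrite /jet_step !mul0r !IH; ring.
Qed.

(** The operators in [p] and [q] commute, so the extra step in [q] can be moved outside the
    recursion on [k]. *)
Lemma jet_recr (beta beta' : F) k l i j m :
  jet beta beta' k l.+1 i j m = jet_step beta' (jet beta beta' k l i) j m.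
Proof.
elim: k i m => [//|k IH] i m /=.
by rewrite /jet_step !IH /jet_step; ring.
Qed.

Lemma jet_sym (beta beta' : F) k l i j m :
  jet beta beta' k l i j m = jet beta' beta l k j i m.
Proof.
elim: k l i j m => [|k IH] l i j m.
  elim: l j m => [//|l IHl] j m; rewrite jet_recr /=.
  exact: eq_jet_step.
by rewrite jet_recr /=; apply: eq_jet_step.
Qed.

Section Shift.
Variables (beta : F) (e : nat -> int -> nat -> F).
Hypothesis e0 : forall i i' m, e 0 i m = e 0 i' m.
Hypothesis eS : forall k i m, k.+1%:R * e k.+1 i m = jet_step beta (e k) i m.

(* Multiplying by p^s = exp(s log p) convolves the Taylor coefficients in log p
   at p = 1 with the coefficients s^u / u! of the exponential. *)
Lemma jet_shift (s : int) k i m :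
  e k (i + s) m = conv (fun u => s%:~R ^+ u / u`!%:R) (fun u => e u i m) k.
Proof.
elim: k i m => [|k IH] i m.
  by rewrite /conv big_ord_recl big_ord0 expr0 fact0 mulr1n divr1 mul1r addr0; apply: e0.
apply: (mulfI (natr_neq0 k)); rewrite eS.
set c := fun u : nat => s%:~R ^+ u / u`!%:R.
(* Conjugation by [p^s] adds [s] to the Euler operator. *)
have -> : jet_step beta (e k) (i + s) m = s%:~R * conv c (fun u => e u i m) k
    + conv c (fun u => jet_step beta (e u) i m) k.
  rewrite /jet_step !convDr -mulN1r !convZr mulN1r -!IH.
  have -> : conv c (fun u => - (m%:R * e u (i + 1) m.+1)) k =
            - (m%:R * e k (i + 1 + s) m.+1).
    rewrite IH -convZr -sumrN; apply: eq_bigr => u _; rewrite mulrN //.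
  by rewrite -!(addrAC i s) rmorphD /=; ring.
have -> : conv c (fun u => jet_step beta (e u) i m) k
   = \sum_(u < k.+1) c u * ((k.+1 - u)%N%:R * e (k.+1 - u)%N i m).
  by apply: eq_bigr => u _; rewrite -eS subSn // leq_ord.
rewrite /conv !mulr_sumr.
(* Leibniz rule: the factor [k+1] is split as [u + (k+1-u)]. *)
have -> : \sum_(u < k.+2) k.+1%:R * (c u * e (k.+1 - u)%N i m)
   = \sum_(u < k.+2) u%:R * c u * e (k.+1 - u)%N i m
   + \sum_(u < k.+2) c u * ((k.+1 - u)%N%:R * e (k.+1 - u)%N i m).
  rewrite -big_split; apply: eq_bigr => u _ /=.
  by rewrite -[X in X%:R * (c u * _)](subnKC (leq_ord u)) natrD; ring.
(* The term [u = 0] of the first sum and the term [u = k+1] of the second vanish; the rest of the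
   first is reindexed by [u s^u/u! = s s^(u-1)/(u-1)!]. *)
rewrite [X in _ = X + _]big_ord_recl [X in _ = _ + X]big_ord_recr /=.
rewrite subnn !mul0r mulr0 addr0 add0r; congr (_ + _).
apply: eq_bigr => u _; rewrite mulrA /bump /= add1n subSS; congr (_ * _).
rewrite /c exprS factS natrM.
have u0 : u`!%:R != 0 :> F by rewrite -(prednK (fact_gt0 u)).
by field; rewrite u0 -[X in X + _]/(1%:R) -natrD natr_neq0.
Qed.

End Shift.

End ConvolutionJets.

(** * Jets weighted by the coefficients [a_k] *)

Section GramEntries.
Variables (a a' : nat -> Cplx) (al ga be be' : Cplx).

(** The double convolution reproduces the sums over [k] and [l] in the matrix entries, with
    [p^i q^j/(p+q)^m] in place of [1/(p+q)]. *)
Definition gram (r s : nat) (i j : int) (m : nat) : Cplx :=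
  conv a (fun k => conv a' (fun l =>
    jet al ga be be' k l i j m / (k`!%:R * l`!%:R)) s) r.

Definition jetvec (r : nat) (i : int) : Cplx :=
  conv a (fun k => qjet al ga be 1 k i 0 / k`!%:R) r.

Lemma gram_rel r s i j m :
  gram r s (i + 1) j m.+1 + gram r s i (j + 1) m.+1 = gram r s i j m.
Proof.
rewrite -convDr; apply: eq_conv => k; rewrite -convDr; apply: eq_conv => l.
by rewrite -mulrDl (jet_rel _ _ natCplx_neq0).
Qed.

(** Multiplication by [p^s] is a convolution, hence commutes with the weighting by [a]; [jet_shift]
    applies to the jets divided by [k!]. *)
Lemma jetvec_shift (s : int) r i :
  jetvec r (i + s) = conv (fun u => s%:~R ^+ u / u`!%:R) (jetvec^~ i) r.
Proof.
rewrite [RHS]convCA; apply: eq_conv => k.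
rewrite (@jet_shift _ al ga natCplx_neq0 be
          (fun k i m => qjet al ga be 1 k i m / k`!%:R)) // => {r i}k i m.
rewrite factS natrM invfM mulrCA mulVKf ?natCplx_neq0 //.
by rewrite /= /jet_step; ring.
Qed.

Lemma gram_shift (t : int) r s i j m :
  gram r s (i + t) j m
    = conv (fun u => t%:~R ^+ u / u`!%:R) (fun u => gram u s i j m) r.
Proof.
rewrite [RHS]convCA; apply: eq_conv => k.
rewrite (@jet_shift _ al ga natCplx_neq0 be (fun k i m => conv a' (fun l =>
    jet al ga be be' k l i j m / (k`!%:R * l`!%:R)) s)) // => {r i}k i {}m.
rewrite /jet_step -mulN1r -!convZr -!convDr.
have k0 := natCplx_neq0 k.
apply: eq_conv => l; rewrite factS natrM !invfM /= /jet_step.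
set X := k`!%:R^-1; set Y := l`!%:R^-1.
by rewrite mulrCA -(mulrA k.+1%:R^-1) mulVKf //; ring.
Qed.

End GramEntries.

(** The source of all rank-one matrices below: at [m = 0] the jets in [p] and [q] separate. *)
Lemma gram0 a a' al ga be be' r s i j :
  gram a a' al ga be be' r s i j 0
    = jetvec a al ga be r i * jetvec a' al ga be' s j.
Proof.
rewrite mulrC /jetvec -convZr; apply: eq_conv => k.
rewrite mulrC -convZr; apply: eq_conv => l.
by rewrite jet0 invfM; ring.
Qed.

Lemma gram_sym a a' al ga be be' r s i j m :
  gram a a' al ga be be' r s i j m = gram a' a al ga be' be s r j i m.
Proof.
rewrite /gram /conv; under eq_bigr do rewrite mulr_sumr.
rewrite exchange_big; apply: eq_bigr => l _; rewrite mulr_sumr.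
by apply: eq_bigr => k _; rewrite jet_sym mulrCA [_`!%:R * _]mulrC.
Qed.

Lemma Cconj_conv f g r :
  Cconj (conv f g r) = conv (Cconj \o f) (Cconj \o g) r.
Proof. by rewrite rmorph_sum; apply: eq_bigr => u _; rewrite rmorphM. Qed.

Lemma Cconj_jet_step al ga be e i m :
  Cconj (jet_step al ga be e i m)
    = jet_step (Cconj al) (Cconj ga) (Cconj be) (fun i m => Cconj (e i m)) i m.
Proof.
by rewrite /jet_step !(rmorphD, rmorphN, rmorphM) rmorph_int rmorph_nat.
Qed.

Lemma Cconj_qjet al ga be l j m :
  Cconj (qjet al ga be 1 l j m) = qjet (Cconj al) (Cconj ga) (Cconj be) 1 l j m.
Proof.
elim: l j m => [|l IH] j m /=.
  by rewrite fmorphV rmorphXn rmorphD rmorph1.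
by rewrite Cconj_jet_step; apply: eq_jet_step.
Qed.

Lemma Cconj_jet al ga be be' k l i j m :
  Cconj (jet al ga be be' k l i j m)
    = jet (Cconj al) (Cconj ga) (Cconj be) (Cconj be') k l i j m.
Proof.
elim: k i m => [|k IH] i m /=; first exact: Cconj_qjet.
by rewrite Cconj_jet_step; apply: eq_jet_step.
Qed.

Lemma Cconj_gram a a' al ga be be' r s i j m :
  Cconj (gram a a' al ga be be' r s i j m)
    = gram (Cconj \o a) (Cconj \o a') (Cconj al) (Cconj ga)
           (Cconj be) (Cconj be') r s i j m.
Proof.
rewrite Cconj_conv; apply: eq_conv => k /=; rewrite Cconj_conv.
apply: eq_conv => l /=.
by rewrite rmorphM fmorphV rmorphM !rmorph_nat /= Cconj_jet.
Qed.

Lemma Cconj_jetvec a al ga be r i :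
  Cconj (jetvec a al ga be r i)
    = jetvec (Cconj \o a) (Cconj al) (Cconj ga) (Cconj be) r i.
Proof.
rewrite Cconj_conv; apply: eq_conv => k /=.
by rewrite rmorphM fmorphV rmorph_nat /= Cconj_qjet.
Qed.

(** * Rules of differentiation in ring notation *)

Lemma CderivD f g y l m : Cderiv f y l -> Cderiv g y m ->
  Cderiv (fun z => f z + g z) y (l + m).
Proof. exact: Cderiv_add. Qed.

Lemma CderivM f g y l m : Cderiv f y l -> Cderiv g y m ->
  Cderiv (fun z => f z * g z) y (l * g y + f y * m).
Proof. exact: Cderiv_mul. Qed.

Lemma Cderiv0 c y : Cderiv (fun _ => c) y (0 : Cplx).
Proof. exact: Cderiv_const. Qed.

Lemma CderivZ c f y l : Cderiv f y l -> Cderiv (fun z => c * f z) y (c * l).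
Proof.
by move=> df; have := CderivM (Cderiv0 c y) df; rewrite mul0r add0r.
Qed.

Lemma CderivN f y l : Cderiv f y l -> Cderiv (fun z => - f z) y (- l).
Proof.
move=> df; rewrite -mulN1r; apply: Cderiv_ext (CderivZ (-1) df) => z.
exact: mulN1r.
Qed.

Lemma CderivV f y l : f y != 0 -> Cderiv f y l ->
  Cderiv (fun z => (f z)^-1) y (- (l / f y ^+ 2)).
Proof. by move=> /eqP fy0 df; rewrite expr2 invfM; exact: Cderiv_inv. Qed.

Lemma CderivX f y l n : Cderiv f y l ->
  Cderiv (fun z => f z ^+ n) y (n%:R * f y ^+ n.-1 * l).
Proof.
move=> df; elim: n => [|n IH]; first by rewrite !mul0r; exact: Cderiv0.
have := CderivM df IH; rewrite /= -natr1 => d.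
suff <- : l * f y ^+ n + f y * (n%:R * f y ^+ n.-1 * l)
        = (n%:R + 1) * f y ^+ n * l.
  by apply: Cderiv_ext d => z; rewrite -exprS.
by case: n {IH d} => [|n] /=; rewrite ?exprS; ring.
Qed.

Lemma Cderiv_eq f y l l' : Cderiv f y l -> l = l' -> Cderiv f y l'.
Proof. by move=> d <-. Qed.

Lemma Cderiv_sum (I : Type) (r : seq I) (P : pred I) (f : I -> R -> Cplx) y l :
  (forall i, Cderiv (f i) y (l i)) ->
  Cderiv (fun z => \sum_(i <- r | P i) f i z) y (\sum_(i <- r | P i) l i).
Proof.
move=> df; elim: r => [|i r IH].
  rewrite big_nil; apply: Cderiv_ext (Cderiv0 0 y) => z; by rewrite big_nil.
rewrite big_cons; case: ifP => Pi.
  by apply: Cderiv_ext (CderivD (df i) IH) => z; rewrite big_cons Pi.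
by apply: Cderiv_ext IH => z; rewrite big_cons Pi.
Qed.

Lemma Cderiv_conv a f y l r : (forall k, Cderiv (f k) y (l k)) ->
  Cderiv (fun z => conv a (fun k => f k z) r) y (conv a l r).
Proof. by move=> df; apply: Cderiv_sum => u; apply: CderivZ. Qed.

(** * Dependence of the jets on the phase parameters *)

Section ParameterDerivatives.
Variables (al ga be be' : R -> Cplx) (y : R) (da db db' dc : Cplx).
Hypotheses (hal : Cderiv al y da) (hbe : Cderiv be y (2%:R * db))
  (hbe' : Cderiv be' y (2%:R * db')) (hga : Cderiv ga y (3%:R * dc)).

(* The exponential phase is [al p + be p^2/2 + ga p^3/3], whence the factors
   [2] and [3] above; subtracting [e i] normalises it at [p = 1]. *)
Definition phase_step (c : Cplx) (e : int -> Cplx) (i : int) : Cplx :=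
  da * (e (i + 1) - e i) + c * (e (i + 2) - e i) + dc * (e (i + 3) - e i).

Lemma Cderiv_jet_step bt dbt (e : R -> int -> nat -> Cplx) de i m :
  Cderiv bt y (2%:R * dbt) ->
  (forall i m, Cderiv (fun z => e z i m) y (de i m)) ->
  Cderiv (fun z => jet_step (al z) (ga z) (bt z) (e z) i m) y
    (jet_step (al y) (ga y) (bt y) de i m
     + (da * e y (i + 1) m + 2%:R * dbt * e y (i + 2) m
        + 3%:R * dc * e y (i + 3) m)).
Proof.
move=> hbt he.
have hT := CderivD (CderivD (CderivM hal (he (i + 1) m))
  (CderivM hbt (he (i + 2) m))) (CderivM hga (he (i + 3) m)).
have hS := CderivD (CderivZ i%:~R (he i m))
             (CderivN (CderivZ m%:R (he (i + 1) m.+1))).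
by apply: Cderiv_eq (CderivD hS hT) _; rewrite /jet_step; ring.
Qed.

(** With [theta] the phase, the operator is [D = e^(-theta) (q d/dq) e^theta]. Hence the parameter
    derivative of [D^l f] is [D^l (theta' f) - theta' D^l f], and at [q = 1] this is
    [phase_step]. *)
Lemma Cderiv_qjet bt dbt l j m : Cderiv bt y (2%:R * dbt) ->
  Cderiv (fun z => qjet (al z) (ga z) (bt z) 1 l j m) y
    (phase_step dbt (fun j => qjet (al y) (ga y) (bt y) 1 l j m) j).
Proof.
move=> hbt; elim: l j m => [|l IH] j m.
  by rewrite /phase_step /= !subrr !mulr0 !addr0; exact: Cderiv0.
apply: Cderiv_eq (Cderiv_jet_step j m hbt IH) _.
rewrite /phase_step /= /jet_step /phase_step !rmorphD /=.
rewrite !(addrAC j 1 2) !(addrAC j 1 3) !(addrAC j 2 3).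
ring.
Qed.

Lemma Cderiv_jet k l i j m :
  Cderiv (fun z => jet (al z) (ga z) (be z) (be' z) k l i j m) y
    (phase_step db (fun i => jet (al y) (ga y) (be y) (be' y) k l i j m) i
     + phase_step db' (fun j => jet (al y) (ga y) (be y) (be' y) k l i j m) j).
Proof.
elim: k i m => [|k IH] i m.
  rewrite {1}/phase_step /= !subrr !mulr0 !addr0 add0r.
  exact: Cderiv_qjet.
apply: Cderiv_eq (Cderiv_jet_step i m hbe IH) _.
rewrite /phase_step /= /jet_step /phase_step !rmorphD /=.
rewrite !(addrAC i 1 2) !(addrAC i 1 3) !(addrAC i 2 3).
ring.
Qed.

Lemma Cderiv_jetvec a r i :
  Cderiv (fun z => jetvec a (al z) (ga z) (be z) r i) y
    (phase_step db (jetvec a (al y) (ga y) (be y) r) i).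
Proof.
apply: (Cderiv_eq (Cderiv_conv (l := fun k => phase_step db
  (fun i => qjet (al y) (ga y) (be y) 1 k i 0 / k`!%:R) i) _ _ _)).
  move=> k; apply: (Cderiv_eq (CderivM (Cderiv_qjet k i 0 hbe) (Cderiv0 _ y))).
  by rewrite mulr0 addr0 /phase_step; ring.
rewrite /phase_step !mulrBr -!mulNr -!convZr -!convDr.
by apply: eq_conv => k; ring.
Qed.

Lemma Cderiv_gram a a' r s i j m :
  Cderiv (fun z => gram a a' (al z) (ga z) (be z) (be' z) r s i j m) y
    (phase_step db (fun i => gram a a' (al y) (ga y) (be y) (be' y) r s i j m) i
     + phase_step db' (fun j => gram a a' (al y) (ga y) (be y) (be' y) r s i j m) j).
Proof.
apply: (Cderiv_eq (Cderiv_conv (l := fun k => conv a' (fun l =>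
  phase_step db (fun i => jet (al y) (ga y) (be y) (be' y) k l i j m
     / (k`!%:R * l`!%:R)) i
  + phase_step db' (fun j => jet (al y) (ga y) (be y) (be' y) k l i j m
     / (k`!%:R * l`!%:R)) j) s) _ _ _)).
  move=> k; apply: Cderiv_conv => l.
  apply: (Cderiv_eq (CderivM (Cderiv_jet k l i j m) (Cderiv0 _ y))).
  by rewrite mulr0 addr0 /phase_step; ring.
rewrite /phase_step !mulrBr -!mulNr -!convZr -!convDr.
by apply: eq_conv => k; rewrite -!convZr -!convDr; apply: eq_conv => l; ring.
Qed.

End ParameterDerivatives.

(** * The matrix entries as jets *)

Lemma RtoC_neq0 p : Rlt 0 p -> RtoC p != 0.
Proof.
by move=> p0; apply/eqP => /RtoC_eq0 pE; apply: (Rgt_not_eq _ _ p0).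
Qed.

Lemma fact_factorial n : Factorial.fact n = n`!.
Proof. by elim: n => // n IH; rewrite factS /= IH. Qed.

Lemma CsumE n f : Csum n f = \sum_(k < n.+1) f k.
Proof.
elim: n => [|n IH]; first by rewrite big_ord_recl big_ord0 addr0.
by rewrite big_ord_recr -IH.
Qed.

(** * Powers of an Euler operator on an invariant family of functions *)

Section EulerIterates.
Variables (I : Type) (W : R -> Cplx) (e : I -> R -> Cplx).
Variables (step : I -> seq (Cplx * I)) (val : nat -> I -> Cplx).

Definition euler_op (g : R -> Cplx) (p : R) : Cplx :=
  RtoC p * Cder g p + W p * g p.

Definition combo (s : seq (Cplx * I)) (p : R) : Cplx :=
  \sum_(z <- s) z.1 * e z.2 p.

Hypothesis eP : forall i p, Rlt 0 p -> exists2 d,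
  Cderiv (e i) p d & RtoC p * d + W p * e i p = combo (step i) p.
Hypothesis val0 : forall i, val 0 i = e i 1.
Hypothesis valS : forall k i, val k.+1 i = \sum_(z <- step i) z.1 * val k z.2.

Definition step_combo (s : seq (Cplx * I)) : seq (Cplx * I) :=
  flatten [seq [seq (z.1 * w.1, w.2) | w <- step z.2] | z <- s].

Lemma combo_step s p : Rlt 0 p -> exists2 d, Cderiv (combo s) p d &
  RtoC p * d + W p * combo s p = combo (step_combo s) p.
Proof.
move=> p0; elim: s => [|[c i] s [d ds sE]].
  exists 0; last by rewrite /combo !big_nil !mulr0 addr0.
  by apply: Cderiv_ext (Cderiv0 0 p) => z; rewrite /combo big_nil.
have [d' di iE] := eP i p0; exists (c * d' + d).
  by apply: Cderiv_ext (CderivD (CderivZ c di) ds) => z; rewrite /combo big_cons.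
rewrite /combo /= big_cat /= -[X in _ = _ + X]sE big_map /= big_cons /=.
transitivity (c * combo (step i) p + (RtoC p * d + W p * combo s p)).
  by rewrite -iE /combo; ring.
congr (_ + _); rewrite mulr_sumr; apply: eq_bigr => z _ /=; exact: mulrA.
Qed.

(** The operator sends each [e i] to the finite combination [step i], so its powers are computed on
    coefficients; the innermost operator is peeled off first, as in [valS]. *)
Lemma iter_euler_op k s g : (forall p, Rlt 0 p -> g p = combo s p) ->
  Nat.iter k euler_op g (IZR 1) = \sum_(z <- s) z.1 * val k z.2.
Proof.
elim: k s g => [|k IH] s g gE.
  rewrite /= gE; last exact: Rlt_0_1.
  by apply: eq_bigr => z _; rewrite val0.
rewrite Nat.iter_succ_r (IH (step_combo s)).
  rewrite big_flatten /= big_map; apply: eq_bigr => z _.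
  by rewrite big_map valS mulr_sumr; apply: eq_bigr => w _ /=; rewrite mulrA.
move=> p p0; have [d ds <-] := combo_step s p0.
rewrite /euler_op gE //; congr (_ * _ + _); apply: Cder_eq.
(* The radius [p] keeps the neighbourhood inside the half-line where [g] is known. *)
apply: (Cderiv_ext_loc _ _ _ _ _ p0 _ ds) => q qp; rewrite gE //.
by have [? ?] := Rabs_def2 _ _ qp; Lra.lra.
Qed.

End EulerIterates.

Section MEntry.
Variables (al ga be be' : Cplx) (n : nat).

Lemma Cderiv_pole (f : R -> Cplx) p j m : f p != 0 -> Cderiv f p 1 ->
  Cderiv (fun z => RtoC z ^+ j * (f z) ^- m) p
   (j%:R * RtoC p ^+ j.-1 * (f p) ^- m - m%:R * RtoC p ^+ j * (f p) ^- m.+1).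
Proof.
move=> fp0 df; have dj := CderivX j (Cderiv_RtoC p).
have dm := CderivX m (CderivV fp0 df).
have d : Cderiv (fun z => (f z) ^- m) p (- m%:R * (f p) ^- m.+1).
  apply: Cderiv_eq (Cderiv_ext _ _ _ _ _ dm) _ => [z|]; first exact: exprVn.
  case: m {dm} => [|m] /=; first by rewrite oppr0 !mul0r.
  by rewrite -!exprVn !exprS; ring.
apply: Cderiv_eq (CderivM dj d) _.
by rewrite -[C1]/(1 : Cplx) mulr1; ring.
Qed.

Lemma natr_mul_expr (z : Cplx) j : z * (j%:R * z ^+ j.-1) = j%:R * z ^+ j.
Proof. by case: j => [|j] /=; rewrite ?exprS; ring. Qed.

Lemma iter_qjet (W : R -> Cplx) (p : R) l : Rlt 0 p ->
  (forall q, W q = al * RtoC q + be' * (RtoC q * RtoC q)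
                   + ga * (RtoC q * (RtoC q * RtoC q)) - n%:R) ->
  Nat.iter l (euler_op W) (fun q => Cinv (RtoC (Rplus p q))) (IZR 1)
    = qjet al ga be' (RtoC p) l (- n%:Z) 1.
Proof.
move=> p0 WE.
(* The invariant family is [q^j/(p+q)^m]; [step] lists the five terms of its image. *)
pose e (z : nat * nat) q := RtoC q ^+ z.1 * (RtoC p + RtoC q) ^- z.2.
pose step (z : nat * nat) : seq (Cplx * (nat * nat)) :=
  [:: (z.1%:R - n%:R, z); (- z.2%:R, (z.1.+1, z.2.+1)); (al, (z.1.+1, z.2));
      (be', (z.1.+2, z.2)); (ga, (z.1.+3, z.2))].
(* The summand [-n] of the operator is absorbed into the exponent [j - n]. *)
pose val l (z : nat * nat) := qjet al ga be' (RtoC p) l (z.1%:Z - n%:Z) z.2.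
rewrite (@iter_euler_op _ W e step val _ _ _ l [:: (1, (0%N, 1%N))]).
- by rewrite big_cons big_nil /= mul1r addr0 /val /= sub0r.
- move=> [j m] q q0; have pq : RtoC p + RtoC q != 0.
    by rewrite -[_ + _]RtoC_add RtoC_neq0 //; Lra.lra.
  have dpq : Cderiv (fun q => RtoC p + RtoC q) q 1.
    by have := CderivD (Cderiv0 (RtoC p) q) (Cderiv_RtoC q); rewrite add0r.
  eexists; first exact: Cderiv_pole pq dpq.
  rewrite /combo !big_cons big_nil /e /= WE !exprS.
  rewrite mulrBr [_ * (_%:R * _ * _)]mulrA natr_mul_expr.
  ring.
- by move=> [j m]; rewrite /val /e /= expr1n mul1r.
- move=> {}l [j m]; rewrite /val /= /jet_step !big_cons big_nil /=.
  rewrite rmorphB /=.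
  have E h : (h + j)%N%:Z - n%:Z = j%:Z - n%:Z + h%:Z.
    by rewrite addnC PoszD addrAC.
  rewrite -[j.+1]/(1 + j)%N -[j.+2]/(2 + j)%N -[j.+3]/(3 + j)%N !E; ring.
- move=> q q0; rewrite /combo big_cons big_nil /e /= mul1r addr0.
  by rewrite expr0 mul1r expr1 -[_ + _]RtoC_add.
Qed.

(** Differentiation in [p] commutes with the operator in [q] and acts only on the pole. *)
Lemma Cderiv_qjet_base (p : R) l j m : Rlt 0 p ->
  Cderiv (fun z => qjet al ga be' (RtoC z) l j m) p
    (- (m%:R * qjet al ga be' (RtoC p) l j m.+1)).
Proof.
move=> p0; elim: l j m => [|l IH] j m.
  have p1 : RtoC p + 1 != 0.
    by rewrite -[1]/(RtoC 1) -[_ + _]RtoC_add RtoC_neq0 //; Lra.lra.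
  have dp1 : Cderiv (fun z => RtoC z + 1) p 1.
    by have := CderivD (Cderiv_RtoC p) (Cderiv0 1 p); rewrite addr0.
  apply: Cderiv_eq (Cderiv_ext _ _ _ _ _ (Cderiv_pole 0 m p1 dp1)) _ => [z|].
    by rewrite expr0 mul1r.
  by rewrite expr0 !mul0r mulr1 sub0r.
apply: Cderiv_eq (CderivD
  (CderivD (CderivZ j%:~R (IH j m)) (CderivN (CderivZ m%:R (IH (j + 1) m.+1))))
  (CderivD (CderivD (CderivZ al (IH (j + 1) m)) (CderivZ be' (IH (j + 2) m)))
           (CderivZ ga (IH (j + 3) m)))) _.
by rewrite /= /jet_step; ring.
Qed.

Lemma iter_jet (W : R -> Cplx) (J : int) k (T : Type) (r : seq T)
    (c : T -> Cplx) (l : T -> nat) (g : R -> Cplx) :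
  (forall p, W p = al * RtoC p + be * (RtoC p * RtoC p)
                   + ga * (RtoC p * (RtoC p * RtoC p)) + n%:R) ->
  (forall p, Rlt 0 p -> g p = \sum_(z <- r) c z * qjet al ga be' (RtoC p) (l z) J 1) ->
  Nat.iter k (euler_op W) g (IZR 1)
    = \sum_(z <- r) c z * jet al ga be be' k (l z) n%:Z J 1.
Proof.
move=> WE gE.
(* The invariant family is [p^i] times the jets in [q] of [q^J/(p+q)^m]; here [+n] is absorbed into
   the exponent [n + i]. *)
pose e (z : nat * (nat * nat)) p :=
  RtoC p ^+ z.2.1 * qjet al ga be' (RtoC p) z.1 J z.2.2.
pose step (z : nat * (nat * nat)) : seq (Cplx * (nat * (nat * nat))) :=
  let: (l, (i, m)) := z in
  [:: (i%:R + n%:R, z); (- m%:R, (l, (i.+1, m.+1))); (al, (l, (i.+1, m)));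
      (be, (l, (i.+2, m))); (ga, (l, (i.+3, m)))].
pose val k (z : nat * (nat * nat)) :=
  jet al ga be be' k z.1 (n%:Z + z.2.1%:Z) J z.2.2.
rewrite (@iter_euler_op _ W e step val _ _ _ k
  [seq (c z, (l z, (0%N, 1%N))) | z <- r]).
- by rewrite big_map; apply: eq_bigr => z _; rewrite /val /= addr0.
- move=> [l' [i m]] p p0; exists (i%:R * RtoC p ^+ i.-1 * e (l', (0%N, m)) p
      - m%:R * e (l', (i, m.+1)) p).
    apply: Cderiv_eq (CderivM (CderivX i (Cderiv_RtoC p))
      (Cderiv_qjet_base l' J m p0)) _.
    by rewrite /e /= expr0 -[C1]/(1 : Cplx); ring.
  rewrite /combo !big_cons big_nil /e /= WE !exprS expr0.
  rewrite mulrBr [_ * (_%:R * _ * _)]mulrA natr_mul_expr.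
  ring.
- by move=> [l' [i m]]; rewrite /val /e /= expr1n mul1r.
- move=> {}k [l' [i m]]; rewrite /val /= /jet_step !big_cons big_nil /=.
  have E h : n%:Z + (h + i)%N%:Z = n%:Z + i%:Z + h%:Z.
    by rewrite addnC PoszD addrA.
  rewrite rmorphD /= -[i.+1]/(1 + i)%N -[i.+2]/(2 + i)%N -[i.+3]/(3 + i)%N !E.
  ring.
- move=> p p0; rewrite gE // /combo big_map; apply: eq_bigr => z _.
  by rewrite /e /= expr0 mul1r.
Qed.

End MEntry.

Lemma m_entryE a v x t n r s :
  m_entry a v x t n r s
    = gram a (Cconj \o a) (RtoC (x - 3 * v * t)) (RtoC (- 3 * v * t))
        (mkC 0 (2 * t)) (mkC 0 (- 2 * t)) r s n%:Z (- n%:Z) 1.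
Proof.
rewrite /m_entry CsumE /gram /conv; apply: eq_bigr => k _.
set G := fun p : R => _.
set al := RtoC _; set ga := RtoC _; set be := mkC _ _; set be' := mkC _ _.
have GE p : Rlt 0 p -> G p = \sum_(l < s.+1)
    (Cconj (a l) / (s - l)`!%:R) * qjet al ga be' (RtoC p) (s - l) (- n%:Z) 1.
  move=> p0; rewrite /G CsumE; apply: eq_bigr => l _.
  rewrite /Cdiv /Cfact fact_factorial -natCplx; congr (_ * _).
  apply: (@iter_qjet al ga be' n (fun q => Csub (Defs.eta v x t q) (RtoC (INR n)))) => //.
  by move=> q; rewrite etaE natCplx.
have := @iter_jet al ga be be' n (fun p => Cadd (xi v x t p) (RtoC (INR n)))
  (- n%:Z) (r - k) _ _ _ _ G _ GE => /(_ _)/= ->; last first.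
  by move=> p; rewrite xiE natCplx.
rewrite /Cdiv /Cfact fact_factorial -natCplx.
set T := \sum_(z < _) _; rewrite -[LHS]/(a k * (r - k)`!%:R^-1 * T) -mulrA.
congr (_ * _); rewrite mulr_sumr; apply: eq_bigr => l _ /=.
by rewrite invfM; ring.
Qed.

(** * Determinants and derivatives of matrices *)

Lemma CdetE N M : Cdet N M = \det (\matrix_(i < N, j < N) M i j).
Proof.
elim: N M => [|N IH] M; first by rewrite det_mx00.
rewrite (expand_det_row _ ord0) /= CsumE; apply: eq_bigr => j _.
have powE k : Cpow (Copp C1) k = (-1) ^+ k by elim: k => //= k ->; rewrite exprS.
rewrite powE IH /cofactor /= add0n !mxE.
rewrite -[LHS]/((-1) ^+ j * M 0%N j * _) mulrA [_ * M _ _]mulrC.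
congr (_ * _ * \det _); apply/matrixP => p q; rewrite !mxE /minor0 /= /bump.
by case: Nat.ltb_spec0 => /ssrnat.leP; rewrite ?add1n; [rewrite ltnNge => /negbTE->|rewrite -leqNgt => ->].
Qed.

(** The block matrix with unit diagonal blocks and off-diagonal blocks [u], [w] has two block
    triangular factorisations, whose determinants are compared. *)
Lemma det_one_sub_rank1 (F : comPzRingType) N (u : 'cV[F]_N) (w : 'rV[F]_N) :
  \det (1%:M - u *m w) = 1 - (w *m u) 0 0.
Proof.
have e1 : block_mx (1%:M : 'M_N) 0 w (1%:M : 'M_1) *m block_mx 1%:M u 0 (1%:M - w *m u)
    = block_mx 1%:M u w 1%:M.
  by rewrite mulmx_block !(mulmx1, mul1mx, mulmx0, mul0mx) !addr0 addrC subrK.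
have e2 : block_mx (1%:M - u *m w) u 0 (1%:M : 'M_1) *m block_mx (1%:M : 'M_N) 0 w 1%:M
    = block_mx 1%:M u w 1%:M.
  by rewrite mulmx_block !(mulmx1, mul1mx, mulmx0, mul0mx) !add0r subrK.
have := congr1 determinant (etrans e2 (esym e1)).
rewrite !det_mulmx !det_lblock !det_ublock !det1 !mulr1 !mul1r => ->.
by rewrite det_mx11 !mxE.
Qed.

Lemma Cderiv_unique f y l m : Cderiv f y l -> Cderiv f y m -> l = m.
Proof. by move=> /Cder_eq <- /Cder_eq. Qed.

Definition mxderiv m n (A : R -> 'M[Cplx]_(m, n)) y (A' : 'M_(m, n)) :=
  forall i j, Cderiv (fun z => A z i j) y (A' i j).

Lemma mxderivM m n p (A : R -> 'M_(m, n)) (B : R -> 'M_(n, p)) y A' B' :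
  mxderiv A y A' -> mxderiv B y B' ->
  mxderiv (fun z => A z *m B z) y (A' *m B y + A y *m B').
Proof.
move=> dA dB i j; rewrite !mxE -big_split.
apply: Cderiv_ext (Cderiv_sum _ _ (fun k => CderivM (dA i k) (dB k j))) => z.
by rewrite mxE.
Qed.

Lemma Cdiff_prod (I : Type) (r : seq I) (f : I -> R -> Cplx) y :
  (forall i, Cdiff (f i) y) -> Cdiff (fun z => \prod_(i <- r) f i z) y.
Proof.
move=> df; elim: r => [|i r [l IH]].
  by exists 0; apply: Cderiv_ext (Cderiv0 1 y) => z; rewrite big_nil.
have [m dm] := df i; exists (m * (\prod_(k <- r) f k y) + f i y * l).
by apply: Cderiv_ext (CderivM dm IH) => z; rewrite big_cons.
Qed.

Lemma Cdiff_det n (A : R -> 'M_n) y A' :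
  mxderiv A y A' -> Cdiff (fun z => \det (A z)) y.
Proof.
move=> dA; rewrite /determinant.
have h (s : 'S_n) : Cdiff (fun z => (-1) ^+ s * \prod_i A z i (s i)) y.
  have [l dl] := Cdiff_prod (index_enum 'I_n) (fun i => ex_intro _ _ (dA i (s i))).
  by eexists; exact: CderivZ dl.
have hs (s : 'S_n) : {l | Cderiv (fun z => (-1) ^+ s * \prod_i A z i (s i)) y l}.
  exact/cid/h.
by eexists; exact: (Cderiv_sum _ _ (fun s => svalP (hs s))).
Qed.

Lemma det_neq0_near n (A : R -> 'M_n) y A' : mxderiv A y A' -> \det (A y) != 0 ->
  exists2 d, Rlt 0 d & forall z, Rlt (Rabs (Rminus z y)) d -> \det (A z) != 0.
Proof.
move=> dA /eqP Ay; have [l dl] := Cdiff_det dA.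
have [d [d0 dP]] := Cderiv_neq0 _ _ _ dl Ay.
by exists d => // z zy; apply/eqP; exact: dP.
Qed.

(** Differentiability comes from the adjugate formula, valid near [y]; the value then follows by
    differentiating [A A^-1 = 1]. *)
Lemma mxderiv_inv n (A : R -> 'M_n) y A' : mxderiv A y A' -> \det (A y) != 0 ->
  mxderiv (fun z => invmx (A z)) y (- (invmx (A y) *m A' *m invmx (A y))).
Proof.
move=> dA Ay.
have Au : A y \in unitmx by rewrite unitmxE unitfE.
have [d d0 dP] := det_neq0_near dA Ay.
have diffB i j : {l | Cderiv (fun z => invmx (A z) i j) y l}.
  apply: cid; have [l dl] := Cdiff_det dA.
  have [m dm] : Cdiff (fun z => \adj (A z) i j) y.
    have [k dk] : Cdiff (fun z => \det (row' j (col' i (A z)))) y.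
      apply: (@Cdiff_det _ _ _ (row' j (col' i A'))) => r s; rewrite !mxE.
      by apply: Cderiv_ext (dA _ _) => z; rewrite !mxE.
    exists ((-1) ^+ (j + i) * k); apply: Cderiv_ext (CderivZ _ dk) => z.
    by rewrite [RHS]mxE.
  eexists; apply: Cderiv_ext_loc d0 _ (CderivM (CderivV Ay dl) dm) => z zy.
  by rewrite /invmx unitmxE unitfE dP // [RHS]mxE.
pose B' : 'M_n := \matrix_(i, j) sval (diffB i j).
have dB : mxderiv (fun z => invmx (A z)) y B'.
  by move=> i j; rewrite mxE; case: (diffB i j).
have E0 : A' *m invmx (A y) + A y *m B' = 0.
  apply/matrixP => i j; rewrite [RHS]mxE.
  apply: (Cderiv_unique (mxderivM dA dB i j)).
  apply: Cderiv_ext_loc d0 _ (Cderiv0 ((1%:M : 'M_n) i j) y) => z zy.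
  by rewrite mulmxV // unitmxE unitfE dP.
suff -> : - (invmx (A y) *m A' *m invmx (A y)) = B' by [].
rewrite -mulmxA -mulmxN; move/eqP: E0; rewrite addrC addr_eq0 => /eqP <-.
by rewrite mulKmx.
Qed.

(** * The brackets [S_{ij}] *)

Lemma gram_shiftr a a' al ga be be' (t : int) r s i j m :
  gram a a' al ga be be' r s i (j + t) m
    = conv (fun u => t%:~R ^+ u / u`!%:R)
           (fun u => gram a a' al ga be be' r u i j m) s.
Proof.
rewrite gram_sym gram_shift; apply: eq_conv => u; exact: gram_sym.
Qed.

(* The matrix of multiplication by p + 1/p = 2 cosh(log p) on the jets of odd
   order: the series is even in log p, so odd orders only see odd orders. *)
Definition cosh_mx N : 'M[Cplx]_N :=
  \matrix_(r, s) if (s <= r)%N then 2%:R / ((r - s).*2)`!%:R else 0.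

Lemma cosh_mxP N (f : nat -> Cplx) (r : 'I_N) :
  conv (fun u => 1%:~R ^+ u / u`!%:R) f r.*2.+1
  + conv (fun u => (- 1)%:~R ^+ u / u`!%:R) f r.*2.+1
    = \sum_(s < N) cosh_mx N r s * f s.*2.+1.
Proof.
have pairs (g : nat -> Cplx) n :
    \sum_(u < n.*2) g u = \sum_(w < n) (g w.*2 + g w.*2.+1).
  by elim: n => [|n IH]; rewrite ?big_ord0 // doubleS !big_ord_recr /= IH addrA.
rewrite -big_split /=.
under eq_bigr do rewrite -mulrDl -mulrDl expr1n.
(* The range has even length [2r+2], so its terms pair off; in each pair the odd [u] contributes
   zero. *)
rewrite -doubleS (pairs (fun u => (1 + (-1) ^+ u) / u`!%:R * f (r.*2.+1 - u)%N)).
transitivity (\sum_(w < r.+1) 2%:R / w.*2`!%:R * f (r - w).*2.+1).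
  apply: eq_bigr => w _.
  have e : (-1) ^+ w.*2 = 1 :> Cplx by rewrite -signr_odd odd_double.
  rewrite exprS e mulr1 subrr !mul0r addr0.
  by rewrite doubleB subSn // leq_double leq_ord.
(* The index becomes [s = r - w], and the sum is padded with zeros up to [N]. *)
rewrite (reindex_inj rev_ord_inj) /=.
rewrite (big_ord_widen N (fun s => 2%:R / (r.+1 - s.+1).*2`!%:R
                               * f (r - (r.+1 - s.+1)).*2.+1)) //.
rewrite big_mkcond; apply: eq_bigr => s _; rewrite mxE ltnS subSS.
by case: ifP => sr; rewrite ?mul0r // subKn.
Qed.

Section Flow.
Variables (N : nat) (a a' : nat -> Cplx) (al ga be be' : R -> Cplx).

Definition Phi (z : R) (i : int) : 'cV[Cplx]_N :=
  \col_r jetvec a (al z) (ga z) (be z) r.*2.+1 i.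
Definition Psi (z : R) (j : int) : 'rV[Cplx]_N :=
  \row_s jetvec a' (al z) (ga z) (be' z) s.*2.+1 j.
(** With the phases of the theorem, [tau_0] and [tau_1] are the determinants of [Gm z 0 0] and
    [Gm z 1 (-1)]; the index [r] counts from [0], hence the order [r.*2.+1]. *)
Definition Gm (z : R) (i j : int) : 'M[Cplx]_N :=
  \matrix_(r, s) gram a a' (al z) (ga z) (be z) (be' z) r.*2.+1 s.*2.+1 i j 1.
Definition bracket (z : R) (i j : int) : Cplx :=
  (Psi z j *m invmx (Gm z 0 0) *m Phi z i) 0 0.

(** The factor [p+q] cancels the simple pole. *)
Lemma Gm_rel z i j : Gm z (i + 1) j + Gm z i (j + 1) = Phi z i *m Psi z j.
Proof.
by apply/matrixP => r s; rewrite !mxE big_ord1 !mxE gram_rel gram0.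
Qed.

Lemma cosh_Phi z i : cosh_mx N *m Phi z i = Phi z (i + 1) + Phi z (i - 1).
Proof.
apply/colP => r; rewrite !mxE !jetvec_shift cosh_mxP.
by apply: eq_bigr => s _; rewrite [Phi _ _ _ _]mxE.
Qed.

Lemma cosh_Psi z j : Psi z j *m (cosh_mx N)^T = Psi z (j + 1) + Psi z (j - 1).
Proof.
apply/rowP => r; rewrite !mxE !jetvec_shift cosh_mxP.
by apply: eq_bigr => s _; rewrite mulrC [Psi _ _ _ _]mxE [_^T _ _]mxE.
Qed.

Lemma cosh_Gm z i j : cosh_mx N *m Gm z i j = Gm z (i + 1) j + Gm z (i - 1) j.
Proof.
apply/matrixP => r s; rewrite !mxE !gram_shift cosh_mxP.
by apply: eq_bigr => u _; rewrite [Gm _ _ _ _ _]mxE.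
Qed.

Lemma Gm_cosh z i j :
  Gm z i j *m (cosh_mx N)^T = Gm z i (j + 1) + Gm z i (j - 1).
Proof.
apply/matrixP => r s; rewrite !mxE !gram_shiftr cosh_mxP.
by apply: eq_bigr => u _; rewrite mulrC [Gm _ _ _ _ _]mxE [_^T _ _]mxE.
Qed.

(** This is [p + 1/p + q + 1/q = (p+q)(1 + 1/(pq))] applied to [1/(p+q)]. *)
Lemma Gm_sylvester z :
  cosh_mx N *m Gm z 0 0 + Gm z 0 0 *m (cosh_mx N)^T
    = Phi z 0 *m Psi z 0 + Phi z (-1) *m Psi z (-1).
Proof.
by rewrite cosh_Gm Gm_cosh -!Gm_rel addrACA; congr (_ + _); rewrite addrC.
Qed.

Lemma bracket_rank1 z p q i j :
  (Psi z j *m invmx (Gm z 0 0) *m (Phi z p *m Psi z q) *m invmx (Gm z 0 0)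
     *m Phi z i) 0 0 = bracket z p j * bracket z i q.
Proof. by rewrite /bracket !mulmxA -!(mulmxA (_ *m Phi z p)) mxE big_ord1. Qed.

(** The Sylvester equation is placed between [Psi_j M^-1] and [M^-1 Phi_i]; on the left [J] then
    acts on [Phi_i] and [J^T] on [Psi_j]. *)
Lemma bracket_recurrence z i j : \det (Gm z 0 0) != 0 ->
  bracket z (i + 1) j + bracket z (i - 1) j
  + bracket z i (j + 1) + bracket z i (j - 1)
    = bracket z 0 j * bracket z i 0 + bracket z (-1) j * bracket z i (-1).
Proof.
move=> G0; have Gu : Gm z 0 0 \in unitmx by rewrite unitmxE unitfE.
have addE (A B : 'M[Cplx]_1) : A 0 0 + B 0 0 = (A + B) 0 0 by rewrite mxE.
rewrite -!bracket_rank1 [RHS]addE -mulmxDl -mulmxDl -mulmxDr -Gm_sylvester.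
rewrite mulmxDr mulmxDl -!(mulmxA (Psi z j)) -mulmxDr mulmxA (mulmxK Gu) (mulKmx Gu).
rewrite mulmxDr mulmxDl !mulmxA cosh_Psi -!mulmxA cosh_Phi.
rewrite !(mulmxDr, mulmxDl) -!addE /bracket -!mulmxA.
by rewrite !addrA.
Qed.

Section FlowDerivative.
Variables (y : R) (da db dc : Cplx).
Hypotheses (hal : Cderiv al y da) (hbe : Cderiv be y (2%:R * db))
  (hbe' : Cderiv be' y (2%:R * - db)) (hga : Cderiv ga y (3%:R * dc)).
Hypothesis G0 : \det (Gm y 0 0) != 0.

Definition bracket_flow (S : int -> int -> Cplx) (i j : int) : Cplx :=
  da * (S (i + 1) j + S i (j + 1) - S 0 j * S i 0)
  + db * (S (i + 2) j - S i (j + 2) - S 1 j * S i 0 + S 0 j * S i 1)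
  + dc * (S (i + 3) j + S i (j + 3)
          - S 2 j * S i 0 + S 1 j * S i 1 - S 0 j * S i 2).

(** The symbols are [p+q], [p^2-q^2 = (p+q)(p-q)] and [p^3+q^3 = (p+q)(p^2-pq+q^2)]. The
    normalisation at [p = q = 1] subtracts [2], [0] and [2] respectively. *)
Lemma mxderiv_Gm : mxderiv (fun z => Gm z 0 0) y
  (da *: (Phi y 0 *m Psi y 0 - 2%:R *: Gm y 0 0)
   + db *: (Phi y 1 *m Psi y 0 - Phi y 0 *m Psi y 1)
   + dc *: (Phi y 2 *m Psi y 0 - Phi y 1 *m Psi y 1 + Phi y 0 *m Psi y 2
            - 2%:R *: Gm y 0 0)).
Proof.
move=> r s; apply: Cderiv_eq (Cderiv_ext _ _ _ _ _
  (Cderiv_gram hal hbe hbe' hga a a' r.*2.+1 s.*2.+1 0 0 1)) _ => [z|].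
  by rewrite mxE.
rewrite -!Gm_rel /phase_step !mxE !add0r.
rewrite -[1 + 1]/(2 : int) -[2 + 1]/(3 : int).
ring.
Qed.

Lemma mxderiv_Phi i : mxderiv (fun z => Phi z i) y
  (da *: (Phi y (i + 1) - Phi y i) + db *: (Phi y (i + 2) - Phi y i)
   + dc *: (Phi y (i + 3) - Phi y i)).
Proof.
move=> r s; apply: Cderiv_eq (Cderiv_ext _ _ _ _ _
  (Cderiv_jetvec hal hbe hga a r.*2.+1 i)) _ => [z|]; first by rewrite mxE.
by rewrite /phase_step !mxE.
Qed.

Lemma mxderiv_Psi j : mxderiv (fun z => Psi z j) y
  (da *: (Psi y (j + 1) - Psi y j) - db *: (Psi y (j + 2) - Psi y j)
   + dc *: (Psi y (j + 3) - Psi y j)).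
Proof.
move=> r s; apply: Cderiv_eq (Cderiv_ext _ _ _ _ _
  (Cderiv_jetvec hal hbe' hga a' s.*2.+1 j)) _ => [z|]; first by rewrite mxE.
by rewrite /phase_step !mxE mulNr.
Qed.

(** Product rule for [Psi_j M^-1 Phi_i]: the rank-one parts of [M'] give the quadratic terms, and
    the normalising terms of the three factors cancel. *)
Lemma Cderiv_bracket i j :
  Cderiv (fun z => bracket z i j) y (bracket_flow (bracket y) i j).
Proof.
have Gu : Gm y 0 0 \in unitmx by rewrite unitmxE unitfE.
have dB := mxderiv_inv mxderiv_Gm G0.
apply: Cderiv_eq (mxderivM (mxderivM (mxderiv_Psi j) dB) (mxderiv_Phi i) 0 0) _.
have br p q : (Psi y q *m invmx (Gm y 0 0) *m Phi y p) 0 0 = bracket y p q by [].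
have M0 : Psi y j *m invmx (Gm y 0 0) *m Gm y 0 0 *m invmx (Gm y 0 0) *m Phi y i
  = Psi y j *m invmx (Gm y 0 0) *m Phi y i by rewrite mulmxKV.
have r1 p q := bracket_rank1 y p q i j.
have eD (A B : 'M[Cplx]_1) : (A + B) 0 0 = A 0 0 + B 0 0 by rewrite mxE.
have eN (A : 'M[Cplx]_1) : (- A) 0 0 = - A 0 0 by rewrite mxE.
have eZ c (A : 'M[Cplx]_1) : (c *: A) 0 0 = c * A 0 0 by rewrite mxE.
rewrite mulmxDl mulmxN !mulmxA.
rewrite !(mulmxDl, mulmxDr, mulmxN, mulNmx, scalerDr, scalerN, =^~ scalemxAl, =^~ scalemxAr).
rewrite !(eD, eN, eZ) !M0 !r1 !br /bracket_flow.
ring.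
Qed.

End FlowDerivative.
End Flow.

(** * Polynomial identities among the brackets *)

Section ClosedForm.
Variables (F : comRingType) (S : int -> int -> F).

(** The first three [x]-derivatives of a bracket, as polynomials in brackets; their terms are
    grouped as the product rule produces them. *)
Definition dx1 (i j : int) : F := S (i + 1) j + S i (j + 1) - S 0 j * S i 0.
Definition dx2 (i j : int) : F :=
  dx1 (i + 1) j + dx1 i (j + 1) - (dx1 0 j * S i 0 + S 0 j * dx1 i 0).
Definition dx3 (i j : int) : F :=
  dx2 (i + 1) j + dx2 i (j + 1)
  - (dx2 0 j * S i 0 + dx1 0 j * dx1 i 0 + (dx1 0 j * dx1 i 0 + S 0 j * dx2 i 0)).

(** [flow2] and [flow3] are the coefficients of [db] and [dc] in [bracket_flow]. *)
Definition flow2 (i j : int) : F :=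
  S (i + 2) j - S i (j + 2) - S 1 j * S i 0 + S 0 j * S i 1.
Definition flow3 (i j : int) : F :=
  S (i + 3) j + S i (j + 3) - S 2 j * S i 0 + S 1 j * S i 1 - S 0 j * S i 2.

Hypothesis recS : forall i j,
  S (i + 1) j + S (i - 1) j + S i (j + 1) + S i (j - 1)
    = S 0 j * S i 0 + S (-1) j * S i (-1).

Let u := 1 - S 0 (-1).
Let w := 1 - S (-1) 0.

Let S01 : S 0 1 = S 0 0 * S 0 0 + S (-1) 0 * S 0 (-1) - S 1 0 - S (-1) 0 - S 0 (-1).
Proof. by have := recS 0 0; rewrite !add0r => <-; ring. Qed.
Let S11 : S 1 1 = S 0 0 * S 1 0 + S (-1) 0 * S 1 (-1) - S 2 0 - S 0 0 - S 1 (-1).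
Proof.
have := recS 1 0; rewrite !add0r -[1 + 1]/(2 : int) -[1 - 1]/(0 : int) => <-.
by ring.
Qed.
Let S02 : S 0 2 = S 0 1 * S 0 0 + S (-1) 1 * S 0 (-1) - S 1 1 - S (-1) 1 - S 0 0.
Proof.
have := recS 0 1; rewrite !add0r -[1 + 1]/(2 : int) -[1 - 1]/(0 : int) => <-.
by ring.
Qed.

Let index_norm := (add0r, (erefl : -1 + 1 = 0 :> int), (erefl : 1 + 1 = 2 :> int),
  (erefl : 2 + 1 = 3 :> int), (erefl : -1 + 2 = 1 :> int), (erefl : -1 + 3 = 2 :> int)).

(** The part of the Hirota equation free of [v], divided by the unimodular factor of the solution;
    [u] stands for the solution and [w] for its conjugate. *)
Lemma nls_identity :
  flow2 0 (-1) - 2%:R * u - dx2 0 (-1) + 2%:R * (u * w * u) = 0.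
Proof.
rewrite /flow2 /dx2 /dx1 /u /w !index_norm S01.
by ring.
Qed.

(** The coefficient of [i v] in the Hirota equation, divided by the same factor. *)
Lemma mkdv_identity :
  3%:R * dx1 0 (-1) + flow3 0 (-1) - dx3 0 (-1) - 6%:R * (u * w * dx1 0 (-1)) = 0.
Proof.
(* [S02] is eliminated first, since its expression involves [S11] and [S01]. *)
rewrite /flow3 /dx3 /dx2 /dx1 /u /w !index_norm S02 S11 S01.
by ring.
Qed.

End ClosedForm.

(** * The solution in terms of brackets, and its derivatives *)

Section HirotaSolution.
Variables (v : R) (N : nat) (a : nat -> Cplx).

Let al (x t : R) : Cplx := RtoC (x - 3 * v * t).
Let ga (t : R) : Cplx := RtoC (- 3 * v * t).
Let be (t : R) : Cplx := mkC 0 (2 * t).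
Let be' (t : R) : Cplx := mkC 0 (- 2 * t).

Definition moment_bracket (x t : R) : int -> int -> Cplx :=
  bracket N a (Cconj \o a) (al x) ga be be' t.

Lemma tauE n x t :
  tau a v N n x t = \det (Gm N a (Cconj \o a) (al x) ga be be' t n%:Z (- n%:Z)).
Proof.
rewrite /tau CdetE; congr (\det _); apply/matrixP => i j; rewrite !mxE.
have oddE (k : nat) : (2 * k + 1)%coq_nat = k.*2.+1.
  by rewrite -[LHS]/(2 * k + 1)%N addn1 mul2n.
by rewrite !oddE m_entryE.
Qed.

(** Conjugation exchanges the two phases and the two weights, that is, the roles of [p] and [q]: it
    sends [Phi] to the transpose of [Psi] and [M] to its transpose. *)
Lemma moment_bracket_conj x t i j :
  Cconj (moment_bracket x t i j) = moment_bracket x t j i.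
Proof.
have eal : Cconj (al x t) = al x t by apply: Cplx_ext => //=; exact: Ropp_0.
have ega : Cconj (ga t) = ga t by apply: Cplx_ext => //=; exact: Ropp_0.
have ebe : Cconj (be t) = be' t by apply: Cplx_ext => //=; Lra.lra.
have ebe' : Cconj (be' t) = be t by apply: Cplx_ext => //=; Lra.lra.
have aK : Cconj \o (Cconj \o a) = a by apply: funext => k; exact: CconjK.
have hP k : map_mx Cconj (Phi N a (al x) ga be t k)
    = (Psi N (Cconj \o a) (al x) ga be' t k)^T.
  by apply/matrixP => r s; rewrite !mxE Cconj_jetvec eal ega ebe.
have hQ k : map_mx Cconj (Psi N (Cconj \o a) (al x) ga be' t k)
    = (Phi N a (al x) ga be t k)^T.
  by apply/matrixP => r s; rewrite !mxE Cconj_jetvec eal ega ebe' aK.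
have hG : map_mx Cconj (Gm N a (Cconj \o a) (al x) ga be be' t 0 0)
    = (Gm N a (Cconj \o a) (al x) ga be be' t 0 0)^T.
  apply/matrixP => r s.
  by rewrite !mxE Cconj_gram eal ega ebe ebe' aK gram_sym.
rewrite /moment_bracket /bracket.
set X := Psi _ _ _ _ _ _ j *m _ *m _.
have -> : Cconj (X 0 0) = map_mx Cconj X 0 0 by rewrite [RHS]mxE.
rewrite /X !map_mxM map_invmx hP hQ hG -trmx_inv.
by rewrite -!trmx_mul mxE mulmxA.
Qed.

(** By [Gm_rel] at [(0,-1)] the matrix of [tau_1] is [-(M - Phi_0 Psi_{-1})]; the sign gives
    [(-1)^N] and the determinant lemma the last factor. *)
Lemma phiN_bracket x t : tau a v N 0 x t <> C0 ->
  phiN a v N x t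
    = Cexpi (2 * t) * (-1) ^+ N * (1 - moment_bracket x t 0 (-1)).
Proof.
rewrite /phiN !tauE => /eqP; rewrite -[C0]/(0 : Cplx) => G0.
set G := Gm _ _ _ _ _ _ _ _ _ _ in G0 *.
have Gu : G \in unitmx by rewrite unitmxE unitfE.
have -> : Gm N a (Cconj \o a) (al x) ga be be' t 1 (- (1)%:Z)
   = (- 1) *: (G *m (1%:M - invmx G *m Phi N a (al x) ga be t 0
                       *m Psi N (Cconj \o a) (al x) ga be' t (-1))).
  rewrite mulmxBr mulmx1 -!mulmxA (mulKVmx Gu) -Gm_rel scaleN1r opprB.
  by rewrite -addrA -[-1 + 1]/(0 : int) subrr addr0.
rewrite detZ det_mulmx det_one_sub_rank1.
rewrite -[LHS]/(Cexpi (2 * t) * ((-1) ^+ N * (\det G * _) / \det G)).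
rewrite -!mulrA; congr (_ * (_ * _)).
by rewrite mulrCA mulfV ?mulr1 // /moment_bracket /bracket mulmxA.
Qed.

Let Cderiv_cst0 n c y : Cderiv (fun _ => c) y (n%:R * 0).
Proof. by rewrite mulr0; exact: Cderiv0. Qed.

Let Cderiv_cstN0 n c y : Cderiv (fun _ => c) y (n%:R * - 0).
Proof. by rewrite oppr0; exact: Cderiv_cst0. Qed.

Let Cderiv_al_x x t : Cderiv (fun y => al y t) x 1.
Proof.
have := CderivD (Cderiv_RtoC x) (Cderiv0 (RtoC (- (3 * v * t))) x).
by rewrite addr0; apply: Cderiv_ext => y; rewrite /al [RHS]RtoC_add.
Qed.

Let Cderiv_linear (z w : Cplx) t : Cderiv (fun s => z + w * RtoC s) t w.
Proof.
apply: Cderiv_eq (CderivD (Cderiv0 z t) (CderivZ w (Cderiv_RtoC t))) _.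
by rewrite add0r -[RHS]mulr1.
Qed.

Let Cderiv_al_t x t : Cderiv (al x) t (RtoC (- 3 * v)).
Proof.
apply: Cderiv_ext (Cderiv_linear (RtoC x) _ t) => s.
by apply: Cplx_ext => /=; Lra.lra.
Qed.

Let Cderiv_ga_t t : Cderiv ga t (3%:R * RtoC (- v)).
Proof.
apply: Cderiv_ext (Cderiv_linear 0 _ t) => s.
by rewrite natCplx; apply: Cplx_ext => /=; Lra.lra.
Qed.

Let Cderiv_be_t t : Cderiv be t (2%:R * Ci).
Proof.
apply: Cderiv_ext (Cderiv_linear 0 _ t) => s.
by rewrite natCplx; apply: Cplx_ext => /=; Lra.lra.
Qed.

Let Cderiv_be'_t t : Cderiv be' t (2%:R * - Ci).
Proof.
apply: Cderiv_ext (Cderiv_linear 0 _ t) => s.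
by rewrite natCplx; apply: Cplx_ext => /=; Lra.lra.
Qed.

Lemma Cderiv_bracket_x x t i j : tau a v N 0 x t <> C0 ->
  Cderiv (fun y => moment_bracket y t i j) x (dx1 (moment_bracket x t) i j).
Proof.
rewrite tauE => /eqP G0.
apply: Cderiv_eq (Cderiv_bracket (Cderiv_al_x x t) (Cderiv_cst0 2 (be t) x)
  (Cderiv_cstN0 2 (be' t) x) (Cderiv_cst0 3 (ga t) x) G0 i j) _.
by rewrite /bracket_flow !mul0r !addr0 mul1r.
Qed.

(** In [t] the phase [al p + be p^2/2 + ga p^3/3] moves with velocity [-3v p + i p^2 - v p^3]. *)
Lemma Cderiv_bracket_t x t i j : tau a v N 0 x t <> C0 ->
  Cderiv (fun s => moment_bracket x s i j) t
    (RtoC (- 3 * v) * dx1 (moment_bracket x t) i j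
     + Ci * flow2 (moment_bracket x t) i j
     + RtoC (- v) * flow3 (moment_bracket x t) i j).
Proof.
rewrite tauE => /eqP G0.
exact: Cderiv_bracket (Cderiv_al_t x t) (Cderiv_be_t t) (Cderiv_be'_t t)
  (Cderiv_ga_t t) G0 i j.
Qed.

Lemma tau0_near_x x t : tau a v N 0 x t <> C0 ->
  exists2 d, Rlt 0 d & forall y, Rlt (Rabs (Rminus y x)) d -> tau a v N 0 y t <> C0.
Proof.
rewrite tauE => /eqP G0.
have [d d0 dP] := det_neq0_near (mxderiv_Gm (N := N) a (Cconj \o a)
  (Cderiv_al_x x t) (Cderiv_cst0 2 (be t) x) (Cderiv_cstN0 2 (be' t) x)
  (Cderiv_cst0 3 (ga t) x)) G0.
by exists d => // y yx; rewrite tauE; apply/eqP; exact: dP.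
Qed.

Lemma tau0_near_t x t : tau a v N 0 x t <> C0 ->
  exists2 d, Rlt 0 d & forall s, Rlt (Rabs (Rminus s t)) d -> tau a v N 0 x s <> C0.
Proof.
rewrite tauE => /eqP G0.
have [d d0 dP] := det_neq0_near (mxderiv_Gm (N := N) a (Cconj \o a) (Cderiv_al_t x t)
  (Cderiv_be_t t) (Cderiv_be'_t t) (Cderiv_ga_t t)) G0.
by exists d => // s st; rewrite tauE; apply/eqP; exact: dP.
Qed.

Definition carrier (t : R) : Cplx := Cexpi (2 * t) * (-1) ^+ N.

Lemma carrier_unit t : carrier t * Cconj (carrier t) = 1.
Proof.
rewrite /carrier rmorphM rmorphXn rmorphN1 /= mulrACA -exprMn mulrNN mulr1 expr1n.
by rewrite mulr1; exact: Cexpi_conj.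
Qed.

(** Closed forms hold only where [tau_0] is nonzero; this set is open in [x], so they may be
    differentiated again. *)
Lemma Cderiv_near_x (f g h : R -> Cplx) x t :
  tau a v N 0 x t <> C0 ->
  (forall y, tau a v N 0 y t <> C0 -> f y = g y) ->
  Cderiv g x (h x) -> Cderiv f x (h x).
Proof.
move=> t0 fg dg; have [d d0 dP] := tau0_near_x t0.
by apply: Cderiv_ext_loc d0 _ dg => y yx; rewrite fg //; exact: dP.
Qed.

Let S := moment_bracket.

Lemma Cderiv_dx1 x t i j : tau a v N 0 x t <> C0 ->
  Cderiv (fun y => dx1 (S y t) i j) x (dx2 (S x t) i j).
Proof.
move=> t0; have d i' j' := Cderiv_bracket_x i' j' t0.
exact: CderivD (CderivD (d _ _) (d _ _)) (CderivN (CderivM (d _ _) (d _ _))).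
Qed.

Lemma Cderiv_dx2 x t i j : tau a v N 0 x t <> C0 ->
  Cderiv (fun y => dx2 (S y t) i j) x (dx3 (S x t) i j).
Proof.
move=> t0; have d i' j' := Cderiv_bracket_x i' j' t0.
have d1 i' j' := Cderiv_dx1 i' j' t0.
exact: CderivD (CderivD (d1 _ _) (d1 _ _)) (CderivN (CderivD
  (CderivM (d1 _ _) (d _ _)) (CderivM (d _ _) (d1 _ _)))).
Qed.

Let phi := phiN a v N.
Let phix y s := Cder (fun y' => phi y' s) y.
Let phixx y s := Cder (fun y' => phix y' s) y.

Lemma Cderiv_phi x t : tau a v N 0 x t <> C0 ->
  Cderiv (fun y => phi y t) x (carrier t * - dx1 (S x t) 0 (-1)).
Proof.
move=> t0; apply: (Cderiv_near_x (h := fun x => _) t0 (fun y => @phiN_bracket y t)).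
apply: CderivZ; have := CderivD (Cderiv0 1 x) (CderivN (Cderiv_bracket_x 0 (-1) t0)).
by rewrite add0r.
Qed.

Lemma Cderiv_phix x t : tau a v N 0 x t <> C0 ->
  Cderiv (fun y => phix y t) x (carrier t * - dx2 (S x t) 0 (-1)).
Proof.
move=> t0; apply: (Cderiv_near_x (h := fun x => _) t0
  (fun y y0 => Cder_eq _ _ _ (Cderiv_phi y0))).
exact: CderivZ (CderivN (Cderiv_dx1 0 (-1) t0)).
Qed.

Lemma Cderiv_phixx x t : tau a v N 0 x t <> C0 ->
  Cderiv (fun y => phixx y t) x (carrier t * - dx3 (S x t) 0 (-1)).
Proof.
move=> t0; apply: (Cderiv_near_x (h := fun x => _) t0
  (fun y y0 => Cder_eq _ _ _ (Cderiv_phix y0))).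
exact: CderivZ (CderivN (Cderiv_dx2 0 (-1) t0)).
Qed.

Lemma Cderiv_phi_t x t : tau a v N 0 x t <> C0 ->
  Cderiv (fun s => phi x s) t
    (carrier t * (2%:R * Ci * (1 - S x t 0 (-1))
      - (RtoC (- 3 * v) * dx1 (S x t) 0 (-1) + Ci * flow2 (S x t) 0 (-1)
         + RtoC (- v) * flow3 (S x t) 0 (-1)))).
Proof.
move=> t0; have [d d0 dP] := tau0_near_t t0.
have dc : Cderiv carrier t (2%:R * Ci * carrier t).
  apply: Cderiv_eq (CderivM (Cderiv_expi 2 t) (Cderiv0 _ t)) _.
  have -> : mkC 0 2 = 2%:R * Ci by rewrite natCplx; apply: Cplx_ext => /=; Lra.lra.
  by rewrite mulr0 addr0 /carrier mulrA.
have dS := CderivD (Cderiv0 1 t) (CderivN (Cderiv_bracket_t 0 (-1) t0)).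
apply: Cderiv_eq; first apply: Cderiv_ext_loc d0 _ (CderivM dc dS).
  by move=> s st; rewrite /phi phiN_bracket //; exact: dP.
by rewrite /S; ring.
Qed.

Lemma Ci2 : Ci * Ci = -1.
Proof. by apply: Cplx_ext => /=; Lra.lra. Qed.

Lemma hirota_residual x t : tau a v N 0 x t <> C0 ->
  Ci * Cder (fun s => phi x s) t + phixx x t
  + RtoC 2 * (RtoC (Cnorm2 (phi x t)) * phi x t)
  + Ci * RtoC v * Cder (fun y => phixx y t) x
  + Ci * RtoC (6 * v) * (RtoC (Cnorm2 (phi x t)) * phix x t) = 0.
Proof.
move=> t0; have G0 := t0; move: G0; rewrite tauE => /eqP G0.
have rec i j : S x t (i + 1) j + S x t (i - 1) j + S x t i (j + 1) + S x t i (j - 1)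
    = S x t 0 j * S x t i 0 + S x t (-1) j * S x t i (-1).
  exact: bracket_recurrence.
have nls := nls_identity rec; have mkdv := mkdv_identity rec.
rewrite (Cder_eq _ _ _ (Cderiv_phi_t t0)) (Cder_eq _ _ _ (Cderiv_phixx t0)).
rewrite /phixx (Cder_eq _ _ _ (Cderiv_phix t0)) /phix (Cder_eq _ _ _ (Cderiv_phi t0)).
rewrite RtoC_Cnorm2 /phi phiN_bracket // -/(carrier t).
set c := carrier t in nls mkdv *.
have cc : c * Cconj c = 1 := carrier_unit t.
(* The carrier has modulus one, so the squared modulus of the solution becomes [u w]. *)
have -> (z : Cplx) : Cmul (c * z) (Cconj (c * z)) = z * Cconj z.
  by rewrite -[LHS]/(c * z * Cconj (c * z)) rmorphM mulrACA cc mul1r.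
rewrite rmorphB rmorph1 /= moment_bracket_conj -/(S x t).
have -> : RtoC 2 = 2%:R by rewrite natCplx.
have -> : RtoC (6 * v) = 6%:R * RtoC v.
  by rewrite natCplx; apply: Cplx_ext => /=; Lra.lra.
have -> : RtoC (- 3 * v) = - (3%:R * RtoC v).
  by rewrite natCplx; apply: Cplx_ext => /=; Lra.lra.
have -> : RtoC (- v) = - RtoC v by apply: Cplx_ext => /=; Lra.lra.
set u := 1 - S x t 0 (-1) in nls mkdv *; set w := 1 - S x t (-1) 0 in nls mkdv *.
set X1 := dx1 _ _ _ in nls mkdv *; set X2 := dx2 _ _ _ in nls mkdv *.
set X3 := dx3 _ _ _ in nls mkdv *; set Y2 := flow2 _ _ _ in nls mkdv *.
set Y3 := flow3 _ _ _ in nls mkdv *; set V := RtoC v.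
(* The factor [i^2 + 1] isolates the only use of [i^2 = -1], so that [ring] may treat [i] as an
   indeterminate. *)
transitivity (c * ((Ci * Ci + 1) * (2%:R * u - Y2)
  + (Y2 - 2%:R * u - X2 + 2%:R * (u * w * u))
  + Ci * V * (3%:R * X1 + Y3 - X3 - 6%:R * (u * w * X1)))); first by ring.
by rewrite nls mkdv Ci2; ring.
Qed.

End HirotaSolution.

Unset Implicit Arguments.
Local Close Scope ring_scope.

Theorem mainTheorem1 (v : R) (N : nat) (a : nat -> Cplx) (HN : (0 < N)%coq_nat) :
  let phi := phiN a v N in
  let phix := fun y s => Cder (fun y' => phi y' s) y in
  let phixx := fun y s => Cder (fun y' => phix y' s) y in
  forall x t : R, tau a v N 0 x t <> C0 ->
    Cdiff (fun s => phi x s) t /\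
    Cdiff (fun y => phi y t) x /\
    Cdiff (fun y => phix y t) x /\
    Cdiff (fun y => phixx y t) x /\
    let ph := phi x t in
    let ph_t := Cder (fun s => phi x s) t in
    let ph_x := phix x t in
    let ph_xx := phixx x t in
    let ph_xxx := Cder (fun y => phixx y t) x in
    let m2 := RtoC (Cnorm2 ph) in
    Cadd (Cadd (Cadd (Cadd (Cmul Ci ph_t) ph_xx)
                     (Cmul (RtoC 2) (Cmul m2 ph)))
               (Cmul (Cmul Ci (RtoC v)) ph_xxx))
         (Cmul (Cmul Ci (RtoC (6 * v))) (Cmul m2 ph_x)) = C0.
Proof.
move=> phi phix phixx x t t0; split; first by eexists; exact: Cderiv_phi_t t0.
split; first by eexists; exact: Cderiv_phi t0.
split; first by eexists; exact: Cderiv_phix t0.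
split; first by eexists; exact: Cderiv_phixx t0.
exact: hirota_residual t0.
Qed.
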